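(* Fix $l>0$, $\nu\in\mathbb R\setminus\{0\}$, $\sigma\in\mathbb N$, and at each of the two endpoints of $[0,l]$ fix a boundary condition that is either Dirichlet or Neumann. Let $\mathscr N=\mathbb N$ if at least one boundary condition is Dirichlet and $\mathscr N=\mathbb N\setminus\{1\}$ if both are Neumann. Then there are sets $\gamma_n\subset P$, $n\in\mathscr N$, such that the following hold. (1) $\Lambda_{\mathrm{int}}(\Phi_{\mathrm{int}})=\bigsqcup_{n\in\mathscr N}\gamma_n$, where this is a disjoint union and each $\gamma_n$ is a connected, non self-intersecting curve. (2) If $\phi\in\Phi_{\mathrm{int}}$ and $\Lambda_{\mathrm{int}}(\phi)\in\gamma_n$, then $\phi$ has exactly $n-1$ zeros in the open interval $(0,l)$. (3) Let $\alpha>0$ be fixed. Each $\gamma_n$ intersects the line $\{(\mu,\alpha):\mu\in\mathbb R\}$ exactly once. Writing $(\mu_n,\alpha)$ for this intersection point, the numbers $\mu_n$ are strictly increasing in $n\in\mathscr N$. (4) $\lim_{\alpha\to0}\gamma_n=(\mu_n^{\mathrm{lin}},0)$, i.e. the point of $\gamma_n$ with second coordinate $\alpha$ converges to $(\mu_n^{\mathrm{lin}},0)$ as $\alpha\to0$, where $\mu_n^{\mathrm{lin}}$ is the $n$-th eigenvalue of the linear problem on the interval.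
   Context: $\mathbb N=\{1,2,3,\dots\}$. The real stationary nonlinear Schrödinger equation on $[0,l]$ is $$\mu\phi=-\partial_x^2\phi-(\sigma+1)\nu\phi^{2\sigma+1},\qquad \mu\in\mathbb R,\ \phi\in C^2([0,l],\mathbb R),$$ subject at each endpoint $x_1=0$, $x_2=l$ to the prescribed condition: Dirichlet $\phi(x_j)=0$ or Neumann $\partial_x\phi(x_j)=0$. $\Phi_{\mathrm{int}}$ is the set of functions $\phi\neq0$ on $[0,l]$ which solve this boundary value problem (for the fixed $\nu,\sigma$ and some $\mu\in\mathbb R$) and attain at least one zero in $[0,l]$. For $\phi\in\Phi_{\mathrm{int}}$ the value of $\mu$ is uniquely determined by $\phi$, and $\Lambda_{\mathrm{int}}:\Phi_{\mathrm{int}}\to P$ is the map $\phi\mapsto(\mu,\|\phi\|_\infty)$. The parameter set $P\subset\mathbb R^2$ is defined with $\alpha_0:=|\mu/\nu|^{1/(2\sigma)}$ and $\alpha_{\mathrm c}:=|\mu/((\sigma+1)\nu)|^{1/(2\sigma)}$: if $\nu>0$, $P=P^+:=\{(\mu,\alpha):\mu>0,\ \alpha>0\}\cup\{(\mu,\alpha):\mu\le0,\ \alpha>\alpha_0\}$; if $\nu<0$, $P=P^-:=\{(\mu,\alpha):\mu>0,\ 0<\alpha<\alpha_{\mathrm c}\}$. The linear problem on the interval is $-\partial_x^2\phi=\mu\phi$ on $[0,l]$ with the same boundary conditions; its eigenvalues are indexed increasingly by $n=1,2,3,\dots$. *)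

(* Defs.v *)
From Stdlib Require Import Reals Lra Lia List.
From Coquelicot Require Import Coquelicot.
Open Scope R_scope.

Definition seg (l x : R) : Prop := 0 <= x <= l.

Inductive bc : Set := Dirichlet | Neumann.

Definition bc_at (b : bc) (phi dphi : R -> R) (x : R) : Prop :=
  match b with
  | Dirichlet => phi x = 0
  | Neumann => dphi x = 0
  end.

(* A function on [0,l] is represented by a function on R of which only the
   restriction to [0,l] matters: derivatives are taken within [0,l], hence are
   one-sided at the endpoints. *)
Definition C2_with (l : R) (phi dphi ddphi : R -> R) : Prop :=
  forall x, seg l x ->
    D_in phi dphi (seg l) x /\ D_in dphi ddphi (seg l) x /\
    continue_in ddphi (seg l) x.

Definition solves_nls (l nu : R) (sigma : nat) (b1 b2 : bc) (mu : R)
    (phi : R -> R) : Prop :=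
  exists dphi ddphi : R -> R,
    C2_with l phi dphi ddphi /\
    (forall x, seg l x ->
       mu * phi x =
         - ddphi x - (INR sigma + 1) * nu * phi x ^ (2 * sigma + 1)) /\
    bc_at b1 phi dphi 0 /\ bc_at b2 phi dphi l.

Definition solves_lin (l : R) (b1 b2 : bc) (mu : R) (phi : R -> R) : Prop :=
  exists dphi ddphi : R -> R,
    C2_with l phi dphi ddphi /\
    (forall x, seg l x -> - ddphi x = mu * phi x) /\
    bc_at b1 phi dphi 0 /\ bc_at b2 phi dphi l.

Definition nonzero_on (l : R) (phi : R -> R) : Prop :=
  exists x, seg l x /\ phi x <> 0.

Definition Phi_int (l nu : R) (sigma : nat) (b1 b2 : bc) (phi : R -> R) : Prop :=
  nonzero_on l phi /\
  (exists mu, solves_nls l nu sigma b1 b2 mu phi) /\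
  (exists x, seg l x /\ phi x = 0).

Definition sup_norm (l : R) (phi : R -> R) : R :=
  real (Lub_Rbar (fun y => exists x, seg l x /\ y = Rabs (phi x))).

(* [iota] selects the unique mu; see [solves_nls_mu_unique] below. *)
Definition Lambda_int (l nu : R) (sigma : nat) (b1 b2 : bc) (phi : R -> R)
    : R * R :=
  (iota (fun mu : R => solves_nls l nu sigma b1 b2 mu phi), sup_norm l phi).

(* x^(1/k) for x >= 0. [Rpower 0 y] is 1, so x = 0 has to be treated apart. *)
Definition root (k : nat) (x : R) : R :=
  if Req_dec_T x 0 then 0 else Rpower x (/ INR k).

Definition alpha0 (nu : R) (sigma : nat) (mu : R) : R :=
  root (2 * sigma) (Rabs (mu / nu)).

Definition alphac (nu : R) (sigma : nat) (mu : R) : R :=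
  root (2 * sigma) (Rabs (mu / ((INR sigma + 1) * nu))).

Definition Pplus (nu : R) (sigma : nat) (p : R * R) : Prop :=
  (0 < fst p /\ 0 < snd p) \/
  (fst p <= 0 /\ alpha0 nu sigma (fst p) < snd p).

Definition Pminus (nu : R) (sigma : nat) (p : R * R) : Prop :=
  0 < fst p /\ 0 < snd p < alphac nu sigma (fst p).

Definition Pset (nu : R) (sigma : nat) (p : R * R) : Prop :=
  (0 < nu /\ Pplus nu sigma p) \/ (nu < 0 /\ Pminus nu sigma p).

Definition index_set (b1 b2 : bc) (n : nat) : Prop :=
  match b1, b2 with
  | Neumann, Neumann => (2 <= n)%nat
  | _, _ => (1 <= n)%nat
  end.

Definition has_card (S : R -> Prop) (k : nat) : Prop :=
  exists s : list R, NoDup s /\ length s = k /\ forall x, In x s <-> S x.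

Definition eigenvalue_lin (l : R) (b1 b2 : bc) (mu : R) : Prop :=
  exists phi, nonzero_on l phi /\ solves_lin l b1 b2 mu phi.

(* Under these boundary conditions all eigenvalues are simple, so counting
   distinct eigenvalues agrees with counting them with multiplicity. *)
Definition nth_eigenvalue_lin (l : R) (b1 b2 : bc) (n : nat) (mu : R) : Prop :=
  (1 <= n)%nat /\ eigenvalue_lin l b1 b2 mu /\
  has_card (fun m => eigenvalue_lin l b1 b2 m /\ m < mu) (n - 1).

Definition interval (I : R -> Prop) : Prop :=
  (exists a b, a < b /\ I a /\ I b) /\
  (forall a b x, I a -> I b -> a <= x <= b -> I x).

(* S is homeomorphic to a nondegenerate interval, through mutually inverse
   continuous maps c : I -> S and g : S -> I. Continuity of g excludes sets such
   as a figure eight, which are injective continuous images of an interval. *)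
Definition simple_curve (S : R * R -> Prop) : Prop :=
  exists (I : R -> Prop) (c : R -> R * R) (g : R * R -> R),
    interval I /\
    (forall p, S p <-> exists t, I t /\ c t = p) /\
    (forall t, I t -> g (c t) = t) /\
    (forall t, I t -> filterlim c (within I (locally t)) (locally (c t))) /\
    (forall p, S p -> filterlim g (within S (locally p)) (locally (g p))).

Lemma D_in_seg_unique (l : R) (f d1 d2 : R -> R) (x : R) :
  0 < l -> seg l x -> D_in f d1 (seg l) x -> D_in f d2 (seg l) x -> d1 x = d2 x.
Proof.
intros hl [hx0 hxl] h1 h2.
apply (single_limit _ _ _ _ _) with (2 := h1) (3 := h2).
intros e he.
unfold D_x, seg, Rdist.
pose (t := Rmin (e / 2) (l / 2)).
assert (ht : 0 < t <= l / 2 /\ t < e).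
{ unfold t, Rmin; destruct (Rle_dec (e / 2) (l / 2)); lra. }
destruct (Rle_dec x (l / 2)) as [h | h].
- exists (x + t); split; [lra |].
  rewrite Rabs_right; lra.
- exists (x - t); split; [lra |].
  rewrite Rabs_left; lra.
Qed.

Lemma solves_nls_mu_unique (l nu : R) (sigma : nat) (b1 b2 : bc)
    (phi : R -> R) (mu1 mu2 : R) :
  0 < l -> nonzero_on l phi ->
  solves_nls l nu sigma b1 b2 mu1 phi -> solves_nls l nu sigma b1 b2 mu2 phi ->
  mu1 = mu2.
Proof.
intros hl [x [hx hne]] [d [dd [hC [he _]]]] [d' [dd' [hC' [he' _]]]].
assert (hd : forall y, seg l y -> d' y = d y).
{ intros y hy; apply (D_in_seg_unique l phi); trivial.
  - apply (hC' y hy).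
  - apply (hC y hy). }
assert (hdd : dd x = dd' x).
{ apply (D_in_seg_unique l d); trivial.
  - apply (hC x hx).
  - destruct (hC' x hx) as [_ [h _]].
    intros e epos; destruct (h e epos) as [a [apos ha]].
    exists a; split; [exact apos |].
    intros y [[hy hyx] hya]; rewrite <- (hd y hy), <- (hd x hx).
    apply ha; repeat split; try exact hyx; try exact hya; apply hy. }
apply (Rmult_eq_reg_r (phi x)); [| exact hne].
rewrite (he x hx), (he' x hx), hdd; reflexivity.
Qed.

Lemma Lambda_int_solves (l nu : R) (sigma : nat) (b1 b2 : bc) (phi : R -> R) :
  0 < l -> Phi_int l nu sigma b1 b2 phi ->
  solves_nls l nu sigma b1 b2 (fst (Lambda_int l nu sigma b1 b2 phi)) phi.
Proof.
intros hl [hne [[mu hmu] _]].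
apply (iota_correct (fun m : R => solves_nls l nu sigma b1 b2 m phi)).
exists mu; split; [exact hmu |].
intros m hm; apply (solves_nls_mu_unique l nu sigma b1 b2 phi); trivial.
Qed.

(* Main.v *)
(* Put kappa = nu alpha^(2 sigma) and phi = alpha sin theta. Energy conservation
   at amplitude alpha turns the equation into theta' = sqrt (W theta) with
   W = mu + kappa (1 + s^2 + ... + s^(2 sigma)), s = sin theta, which stays
   positive exactly when (mu, alpha) lies in P. Uniqueness for the second order
   equation shows that every solution with a zero is of this form, where theta
   runs from 0 or PI/2 (Dirichlet or Neumann at 0) to n PI or n PI - PI/2
   (Dirichlet or Neumann at l), passing n - 1 interior multiples of PI. So gamma_n
   is the level set [flight mu alpha = l], where the flight is the integral of
   1/sqrt W between these two angles. At fixed alpha the flight decreases strictly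
   from infinity to 0 in mu, so gamma_n is a graph over alpha; comparing W
   pointwise shows that mu_n is Lipschitz in kappa, also at kappa = 0, where it is
   the linear eigenvalue. *)
Require Import Defs.
From Stdlib Require Import Reals Lra Lia List.
From Stdlib Require Import ZArith FinFun Ranalysis5.
From Coquelicot Require Import Coquelicot.
Open Scope R_scope.

(** Energy conservation by itself gives the squared derivative of phi as a function of phi. Its
    square root vanishes at every turning point, where the first order equation loses uniqueness and
    the time integral is singular. The angle removes this obstacle: 1 - s^(2 sigma + 2) contains the
    factor 1 - s^2 = cos^2 theta, and W is what remains after division by it. Where W > 0, theta is
    strictly increasing on the whole line, the flight has a continuous integrand, and both kinds of
    boundary condition become conditions on theta alone. In W the numbers mu and kappa are treated
    as independent parameters, so every comparison of flights is a pointwise comparison of speeds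
    and kappa = 0 is an ordinary value. The linear problem is the instance n = 0, nu = 0 of the same
    lemmas, except for the constant eigenfunction. Positivity of W has to be proved for a given
    solution. This is where its zero enters: a solution of constant sign may have W negative at some
    angles. *)

(** * Geometric sums and the speed of the angle *)

Definition geo (n : nat) (u : R) : R := sum_f_R0 (pow u) n.

Lemma pow_unit_interval (u : R) (n : nat) : 0 <= u <= 1 -> 0 <= u ^ n <= 1.
Proof.
intros hu; induction n as [| n IH]; simpl; [lra |].
split; [apply Rmult_le_pos; lra |].
replace 1 with (1 * 1) by ring; apply Rmult_le_compat; lra.
Qed.

Lemma geo_bounds (n : nat) (u : R) :
  0 <= u <= 1 -> 1 <= geo n u <= INR n + 1.
Proof.
intros hu; induction n as [| n IH].
- unfold geo; simpl; lra.
- unfold geo in *; rewrite tech5, S_INR.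
  pose proof (pow_unit_interval u (S n) hu); lra.
Qed.

(** Every nonconstant power is at most u. With u = sin^2 this bounds how fast the speed leaves its
    minimum when kappa >= 0. *)
Lemma geo_le_near_0 (n : nat) (u : R) :
  0 <= u <= 1 -> geo n u <= 1 + INR n * u.
Proof.
intros hu; induction n as [| n IH].
- unfold geo; simpl; lra.
- unfold geo in *; rewrite tech5, S_INR; simpl.
  pose proof (pow_unit_interval u n hu); nra.
Qed.

(** Since [1 - u ^ S n = (1 - u) * geo n u], each power loses at most its exponent times 1 - u; the
    square is a crude bound for the sum of the exponents. With 1 - u = cos^2 this is the counterpart
    of [geo_le_near_0] for kappa < 0. *)
Lemma geo_ge_near_1 (n : nat) (u : R) :
  0 <= u <= 1 -> INR n + 1 - (INR n + 1) ^ 2 * (1 - u) <= geo n u.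
Proof.
intros hu; induction n as [| n IH].
- unfold geo; simpl; lra.
- unfold geo in *; rewrite tech5, S_INR.
  assert (h : 1 - (INR n + 1) * (1 - u) <= u ^ S n).
  { pose proof (geo_bounds n u hu) as hb; unfold geo in hb.
    pose proof (GP_finite u n) as hg; simpl in hg.
    replace (n + 1)%nat with (S n) in hg by lia.
    replace (sum_f_R0 (fun n0 : nat => u ^ n0) n) with (sum_f_R0 (pow u) n) in hg
      by reflexivity.
    simpl; simpl in hg; nra. }
  pose proof (pos_INR n); nra.
Qed.

(** The second conjunct is the derivative of [(1 - u) * geo n u = 1 - u ^ (n + 1)]. The value [d]
    stays existential because only this relation is used. *)
Lemma geo_derive (n : nat) (u : R) :
  exists d, is_derive (geo n) u d /\
    - geo n u + (1 - u) * d = - (INR n + 1) * u ^ n.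
Proof.
induction n as [| n [d [hd he]]].
- exists 0; split; [| unfold geo; simpl; ring].
  apply (is_derive_ext (fun _ => 1)); [intros; reflexivity |].
  apply is_derive_Reals, derivable_pt_lim_const.
- exists (d + INR (S n) * u ^ n); split.
  + apply (is_derive_ext (fun x => geo n x + x ^ S n));
      [intros t; unfold geo; rewrite tech5; reflexivity |].
    apply @is_derive_plus; [exact hd |].
    apply is_derive_Reals, derivable_pt_lim_pow.
  + rewrite S_INR; unfold geo in *; rewrite tech5; simpl; lra.
Qed.

Definition speed2 (n : nat) (mu kappa th : R) : R :=
  mu + kappa * geo n (sin th ^ 2).

(* Positivity of [speed2] at sin^2 = 0 and at sin^2 = 1, hence everywhere; for
   kappa = nu alpha^(2n) this is membership in P. *)
Definition nondeg (n : nat) (mu kappa : R) : Prop :=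
  0 < mu + kappa /\ 0 < mu + (INR n + 1) * kappa.

Lemma sin2_unit (t : R) : 0 <= sin t ^ 2 <= 1.
Proof. pose proof (sin2_cos2 t) as h; unfold Rsqr in h; nra. Qed.

(** The speed is affine in [geo], which ranges in [1, n + 1], so its values lie between the two end
    values, whatever the sign of kappa. *)
Lemma speed2_ge (n : nat) (mu kappa c th : R) :
  c <= mu + kappa -> c <= mu + (INR n + 1) * kappa ->
  c <= speed2 n mu kappa th.
Proof.
intros h1 h2; unfold speed2.
pose proof (geo_bounds n _ (sin2_unit th)).
destruct (Rle_dec 0 kappa); nra.
Qed.

Lemma speed2_le (n : nat) (mu kappa c th : R) :
  mu + kappa <= c -> mu + (INR n + 1) * kappa <= c ->
  speed2 n mu kappa th <= c.
Proof.
intros h1 h2; unfold speed2.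
pose proof (geo_bounds n _ (sin2_unit th)).
destruct (Rle_dec 0 kappa); nra.
Qed.

Lemma nondeg_low (n : nat) (mu kappa : R) :
  nondeg n mu kappa -> exists c, 0 < c /\ c <= mu + kappa /\
    c <= mu + (INR n + 1) * kappa.
Proof.
intros [h1 h2]; exists (Rmin (mu + kappa) (mu + (INR n + 1) * kappa)).
split; [apply Rmin_glb_lt; trivial |].
split; [apply Rmin_l | apply Rmin_r].
Qed.

Lemma speed2_pos (n : nat) (mu kappa th : R) :
  nondeg n mu kappa -> 0 < speed2 n mu kappa th.
Proof.
intros h; destruct (nondeg_low _ _ _ h) as [c [hc [h1 h2]]].
pose proof (speed2_ge n mu kappa c th h1 h2); lra.
Qed.

(* Differentiating (1 - s^2) geo (s^2) = 1 - s^(2n+2) produces the power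
   nonlinearity of the equation. *)
Lemma speed2_derive (n : nat) (mu kappa th : R) :
  exists d, is_derive (speed2 n mu kappa) th d /\
    - sin th * speed2 n mu kappa th + cos th * (d / 2) =
      - mu * sin th - (INR n + 1) * kappa * sin th ^ (2 * n + 1).
Proof.
destruct (geo_derive n (sin th ^ 2)) as [d [hd he]].
exists (kappa * (2 * sin th * cos th * d)); split.
- unfold speed2.
  apply (is_derive_ext (fun t => mu + kappa * geo n (sin t ^ 2)));
    [reflexivity |].
  evar_last.
  + apply @is_derive_plus; [apply @is_derive_const |].
    apply is_derive_scal.
    apply (is_derive_comp (geo n)); [exact hd |].
    auto_derive; [trivial | reflexivity].
  + unfold plus, zero, scal; simpl; unfold mult; simpl; ring.
- pose proof (sin2_cos2 th) as h; unfold Rsqr in h.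
  replace (sin th ^ (2 * n + 1)) with (sin th * (sin th ^ 2) ^ n)
    by (rewrite <- pow_mult, Nat.add_1_r; reflexivity).
  unfold speed2.
  replace (cos th * (kappa * (2 * sin th * cos th * d) / 2))
    with (kappa * sin th * ((1 - sin th ^ 2) * d))
    by (replace (1 - sin th ^ 2) with (cos th * cos th) by (simpl; lra); field).
  replace ((1 - sin th ^ 2) * d) with
    (geo n (sin th ^ 2) - (INR n + 1) * (sin th ^ 2) ^ n) by lra.
  ring.
Qed.

Lemma inv_speed_continuous (n : nat) (mu kappa th : R) :
  nondeg n mu kappa ->
  continuous (fun t => / sqrt (speed2 n mu kappa t)) th.
Proof.
intros h.
destruct (speed2_derive n mu kappa th) as [d [hd _]].
pose proof (speed2_pos n mu kappa th h) as hp.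
assert (hs : 0 < sqrt (speed2 n mu kappa th)) by (apply sqrt_lt_R0; trivial).
apply (@ex_derive_continuous R_AbsRing R_NormedModule).
auto_derive; repeat split; trivial; [exists d; exact hd | lra].
Qed.

(** * The flight as a function of the angle and of the parameters *)

(* The x-length in which theta' = sqrt (speed2 theta) leads from a to b. *)
Definition flight (n : nat) (mu kappa a b : R) : R :=
  RInt (fun t => / sqrt (speed2 n mu kappa t)) a b.

Lemma ex_flight (n : nat) (mu kappa a b : R) :
  nondeg n mu kappa ->
  ex_RInt (fun t => / sqrt (speed2 n mu kappa t)) a b.
Proof.
intros h; apply (@ex_RInt_continuous R_CompleteNormedModule).
intros t _; apply inv_speed_continuous; trivial.
Qed.

Lemma flight_split (n : nat) (mu kappa a b c : R) :
  nondeg n mu kappa ->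
  flight n mu kappa a c = flight n mu kappa a b + flight n mu kappa b c.
Proof.
intros h; symmetry.
apply (RInt_Chasles (V := R_CompleteNormedModule)); apply ex_flight; trivial.
Qed.

Lemma flight_pos (n : nat) (mu kappa a b : R) :
  nondeg n mu kappa -> a < b -> 0 < flight n mu kappa a b.
Proof.
intros h hab; apply RInt_gt_0; trivial; intros t _.
- apply Rinv_0_lt_compat, sqrt_lt_R0, speed2_pos; trivial.
- apply inv_speed_continuous; trivial.
Qed.

Lemma flight_point (n : nat) (mu kappa a : R) : flight n mu kappa a a = 0.
Proof. apply (RInt_point (V := R_CompleteNormedModule)). Qed.

Lemma flight_lt_iff (n : nat) (mu kappa a b c : R) :
  nondeg n mu kappa ->
  (flight n mu kappa a b < flight n mu kappa a c <-> b < c).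
Proof.
intros h.
assert (hs : forall b c, b < c -> flight n mu kappa a b < flight n mu kappa a c).
{ intros b' c' hbc; rewrite (flight_split n mu kappa a b' c' h).
  pose proof (flight_pos n mu kappa b' c' h hbc); lra. }
split; [| apply hs].
intros hf; destruct (Rlt_le_dec b c) as [hb | [hb | ->]]; trivial; [| lra].
pose proof (hs c b hb); lra.
Qed.

Lemma flight_derive (n : nat) (mu kappa a b : R) :
  nondeg n mu kappa ->
  is_derive (flight n mu kappa a) b (/ sqrt (speed2 n mu kappa b)).
Proof.
intros h; apply (is_derive_RInt (fun t => / sqrt (speed2 n mu kappa t)) _ a).
- apply filter_forall; intros x.
  apply (RInt_correct (V := R_CompleteNormedModule)), ex_flight; trivial.
- apply inv_speed_continuous; trivial.
Qed.

Lemma flight_lt (n : nat) (mu kappa mu' kappa' a b : R) :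
  nondeg n mu kappa -> nondeg n mu' kappa' -> a < b ->
  (forall t, speed2 n mu kappa t < speed2 n mu' kappa' t) ->
  flight n mu' kappa' a b < flight n mu kappa a b.
Proof.
intros h h' hab hlt; apply RInt_lt; trivial;
  try (intros; apply inv_speed_continuous; trivial).
intros t _; pose proof (speed2_pos n mu kappa t h).
apply Rinv_lt_contravar; [| apply sqrt_lt_1_alt; split; [lra | trivial]].
apply Rmult_lt_0_compat; apply sqrt_lt_R0; trivial; apply speed2_pos; trivial.
Qed.

Lemma flight_const (n : nat) (mu a b : R) :
  flight n mu 0 a b = (b - a) / sqrt mu.
Proof.
unfold flight.
rewrite (RInt_ext _ (fun _ => / sqrt mu)).
- rewrite RInt_const; reflexivity.
- intros t _; unfold speed2; do 2 f_equal; ring.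
Qed.

(** The difference equals (w - y) / (sqrt y sqrt w (sqrt y + sqrt w)), and each root in the
    denominator is at least sqrt d. *)
Lemma inv_sqrt_lipschitz (d y w : R) :
  0 < d -> d <= y -> d <= w ->
  Rabs (/ sqrt y - / sqrt w) <= Rabs (y - w) / (2 * d * sqrt d).
Proof.
intros hd hy hw.
assert (hr : 0 < sqrt d) by (apply sqrt_lt_R0; trivial).
assert (hp : sqrt d <= sqrt y) by (apply sqrt_le_1_alt; trivial).
assert (hq : sqrt d <= sqrt w) by (apply sqrt_le_1_alt; trivial).
assert (ed : d = sqrt d * sqrt d) by (rewrite sqrt_sqrt; lra).
assert (ey : y = sqrt y * sqrt y) by (rewrite sqrt_sqrt; lra).
assert (ew : w = sqrt w * sqrt w) by (rewrite sqrt_sqrt; lra).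
revert hr hp hq ed ey ew.
generalize (sqrt d) (sqrt y) (sqrt w); intros r p q hr hp hq -> -> ->.
replace (/ p - / q) with ((q - p) * / (p * q)) by (field; lra).
replace (p * p - q * q) with ((p - q) * (p + q)) by ring.
unfold Rdiv; rewrite !Rabs_mult, (Rabs_minus_sym q p), Rmult_assoc.
apply Rmult_le_compat_l; [apply Rabs_pos |].
rewrite (Rabs_right (p + q)), (Rabs_right (/ (p * q)));
  [| apply Rle_ge, Rlt_le, Rinv_0_lt_compat; nra | lra].
apply (Rmult_le_reg_r (p * q)); [nra |].
rewrite Rinv_l by nra.
apply (Rmult_le_reg_r (2 * (r * r) * r)); [nra |].
replace ((p + q) * / (2 * (r * r) * r) * (p * q) * (2 * (r * r) * r)) with
  ((p + q) * (p * q)) by (field; lra).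
assert (r * r <= p * q) by (apply Rmult_le_compat; lra).
rewrite Rmult_1_l; replace (2 * (r * r) * r) with (2 * r * (r * r)) by ring.
apply Rmult_le_compat; nra.
Qed.

Lemma flight_continuous (n : nat) (mu kappa a b : R) :
  nondeg n mu kappa -> a <= b ->
  continuity_pt (fun m => flight n m kappa a b) mu.
Proof.
intros h hab.
destruct (nondeg_low _ _ _ h) as [c [hc [h1 h2]]].
(* Lipschitz constant of the inverse root on [c/2, infinity), where the speed stays as long as mu
   moves by less than c/2. *)
pose (K := / (2 * (c / 2) * sqrt (c / 2))).
assert (hK : 0 < K).
{ apply Rinv_0_lt_compat, Rmult_lt_0_compat; [lra |].
  apply sqrt_lt_R0; lra. }
intros e he.
(* The summand 1 keeps the denominator positive when a = b. *)
exists (Rmin (c / 2) (e / ((b - a + 1) * K))); split.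
{ apply Rmin_glb_lt; [lra |]; apply Rdiv_lt_0_compat; [trivial |].
  apply Rmult_lt_0_compat; lra. }
intros m [_ hm]; simpl in hm |- *; unfold Rdist in hm |- *.
assert (hm1 : Rabs (m - mu) < c / 2)
  by (apply Rlt_le_trans with (1 := hm), Rmin_l).
assert (hm2 : Rabs (m - mu) < e / ((b - a + 1) * K))
  by (apply Rlt_le_trans with (1 := hm), Rmin_r).
apply Rabs_def2 in hm1.
assert (hn : nondeg n m kappa) by (split; lra).
unfold flight.
rewrite <- (RInt_minus (V := R_CompleteNormedModule)) by (apply ex_flight; trivial).
apply Rle_lt_trans with ((b - a) * (Rabs (m - mu) * K)).
- apply abs_RInt_le_const; trivial.
  { apply @ex_RInt_minus; apply ex_flight; trivial. }
  intros t _.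
  replace (Rabs (m - mu)) with (Rabs (speed2 n m kappa t - speed2 n mu kappa t))
    by (f_equal; unfold speed2; ring).
  apply inv_sqrt_lipschitz; [lra | |].
  + apply speed2_ge; lra.
  + apply speed2_ge; lra.
- apply Rle_lt_trans with ((b - a + 1) * (Rabs (m - mu) * K)).
  { apply Rmult_le_compat_r; [| lra].
    apply Rmult_le_pos; [apply Rabs_pos | lra]. }
  apply (Rmult_lt_compat_r ((b - a + 1) * K)) in hm2;
    [| apply Rmult_lt_0_compat; lra].
  replace (e / ((b - a + 1) * K) * ((b - a + 1) * K)) with e in hm2
    by (field; lra).
  lra.
Qed.

Lemma flight_mu_lt_iff (n : nat) (mu mu' kappa a b : R) :
  nondeg n mu kappa -> nondeg n mu' kappa -> a < b ->
  (flight n mu' kappa a b < flight n mu kappa a b <-> mu < mu').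
Proof.
intros h h' hab.
assert (hs : forall m m', nondeg n m kappa -> nondeg n m' kappa -> m < m' ->
  flight n m' kappa a b < flight n m kappa a b).
{ intros m m' hm hm' hlt; apply flight_lt; trivial.
  intros t; unfold speed2; lra. }
split; [| apply hs; trivial].
intros hf; destruct (Rlt_le_dec mu mu') as [hb | [hb | ->]]; trivial; [| lra].
pose proof (hs mu' mu h' h hb); lra.
Qed.

(** * Solving for mu at a prescribed flight *)

Lemma is_RInt_inv_affine (p q a b : R) :
  q <> 0 -> a <= b -> (forall t, a <= t <= b -> 0 < p + q * t) ->
  is_RInt (fun t => / (p + q * t)) a b ((ln (p + q * b) - ln (p + q * a)) / q).
Proof.
intros hq hab hpos.
replace ((ln (p + q * b) - ln (p + q * a)) / q) with
  (minus (ln (p + q * b) / q) (ln (p + q * a) / q))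
  by (unfold minus, plus, opp; simpl; field; trivial).
apply (is_RInt_derive (fun t => ln (p + q * t) / q) (fun t => / (p + q * t)));
  rewrite Rmin_left, Rmax_right by trivial; intros t ht; specialize (hpos t ht).
- auto_derive; [trivial | field; lra].
- apply (@ex_derive_continuous R_AbsRing R_NormedModule).
  auto_derive; lra.
Qed.

Lemma sqrt_add_sqr_le (r w s x : R) :
  0 <= r -> 0 <= w -> x <= r ^ 2 + w ^ 2 * s ^ 2 ->
  sqrt x <= r + w * Rabs s.
Proof.
intros hr hw hx.
pose proof (Rabs_pos s) as hs.
assert (0 <= w * Rabs s) by (apply Rmult_le_pos; trivial).
rewrite <- (sqrt_Rsqr (r + w * Rabs s)) by lra.
apply sqrt_le_1_alt; unfold Rsqr.
rewrite <- (pow2_abs s) in hx; nra.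
Qed.

Lemma abs_sin_le (x : R) : Rabs (sin x) <= Rabs x.
Proof.
assert (h : forall y, 0 <= y -> Rabs (sin y) <= y).
{ intros y [hy | <-]; [| rewrite sin_0, Rabs_R0; lra].
  pose proof (sin_lt_x y hy).
  destruct (Rle_dec 0 (sin y)) as [h0 | h0]; [rewrite Rabs_right; lra |].
  rewrite Rabs_left by lra.
  destruct (Rle_dec y PI) as [h1 | h1].
  - pose proof (sin_ge_0 y); lra.
  - pose proof (SIN_bound y); pose proof PI2_1; lra. }
destruct (Rle_dec 0 x) as [hx | hx].
- rewrite (Rabs_right x) by lra; apply h; trivial.
- rewrite <- (Rabs_Ropp (sin x)), <- sin_neg, (Rabs_left x) by lra; apply h; lra.
Qed.

(* The speed is at most r + w |t - t0| near the angle t0 where it degenerates as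
   r tends to 0, so the flight grows like (1/w) ln (1/r). *)
Lemma flight_unbounded (n : nat) (kappa a b l : R) :
  a = 0 \/ a = PI / 2 -> a + PI / 2 <= b -> 0 < l ->
  exists mu, nondeg n mu kappa /\ l < flight n mu kappa a b.
Proof.
intros ha hb hl.
pose proof PI2_1 as hpi.
(* A slope whose square dominates the quadratic growth of the speed from its minimum, for either
   sign of kappa ([hw0], [hw1]). *)
pose (w := (INR n + 1) * (1 + Rabs kappa)).
assert (hn := pos_INR n).
assert (hk := Rabs_pos kappa).
assert (hw : 0 < w) by (apply Rmult_lt_0_compat; lra).
(* Chosen so that (ln (w PI/2) - ln r) / w = l; the integral of the inverse affine majorant then
   exceeds l. *)
pose (r := w * (PI / 2) * exp (- (w * l))).
assert (hr : 0 < r).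
{ apply Rmult_lt_0_compat; [apply Rmult_lt_0_compat; lra | apply exp_pos]. }
assert (hw0 : INR n * Rabs kappa <= w ^ 2) by (unfold w; nra).
assert (hw1 : (INR n + 1) ^ 2 * Rabs kappa <= w ^ 2).
{ unfold w; rewrite Rpow_mult_distr.
  apply Rmult_le_compat_l; [apply pow_le; lra | nra]. }
(* The affine majorant p + q t of the root of the speed rises or falls according to which end of the
   quarter turn is degenerate; r is its smallest value there. *)
assert (hbound : forall (p q : R), q = w \/ q = - w ->
  Rmin (p + q * a) (p + q * (a + PI / 2)) = r ->
  Rabs (ln (p + q * (a + PI / 2)) - ln (p + q * a)) =
    ln (r + w * (PI / 2)) - ln r /\
  forall t, a <= t <= a + PI / 2 -> r <= p + q * t).
{ intros p q [-> | ->] hm.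
  - rewrite Rmin_left in hm by nra.
    replace (p + w * (a + PI / 2)) with (r + w * (PI / 2)) by lra.
    rewrite hm; split; [| intros; nra].
    apply Rabs_right, Rle_ge, Rlt_le, Rlt_0_minus, ln_increasing; nra.
  - rewrite Rmin_right in hm by nra.
    replace (p + - w * a) with (r + w * (PI / 2)) by lra.
    rewrite hm; split; [| intros; nra].
    rewrite Rabs_minus_sym.
    apply Rabs_right, Rle_ge, Rlt_le, Rlt_0_minus, ln_increasing; nra. }
assert (hmain : forall mu p q, nondeg n mu kappa ->
  q = w \/ q = - w -> Rmin (p + q * a) (p + q * (a + PI / 2)) = r ->
  (forall t, a <= t <= a + PI / 2 ->
     sqrt (speed2 n mu kappa t) <= p + q * t) ->
  l < flight n mu kappa a b).
{ intros mu p q hnd hq hm hle.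
  destruct (hbound p q hq hm) as [e hge].
  (* The first quarter turn suffices, since one of its ends is a degenerate angle. *)
  apply Rlt_le_trans with (flight n mu kappa a (a + PI / 2)).
  2:{ rewrite (flight_split _ _ _ a (a + PI / 2) b) by trivial.
      destruct hb as [hb | <-]; [| rewrite flight_point; lra].
      pose proof (flight_pos n mu kappa (a + PI / 2) b hnd hb); lra. }
  pose proof (is_RInt_inv_affine p q a (a + PI / 2)) as hI.
  assert (hI' := hI ltac:(lra) ltac:(lra)
    ltac:(intros t ht; specialize (hge t ht); lra)); clear hI.
  apply Rlt_le_trans with
    ((ln (p + q * (a + PI / 2)) - ln (p + q * a)) / q).
  - replace ((ln (p + q * (a + PI / 2)) - ln (p + q * a)) / q) with
      ((ln (r + w * (PI / 2)) - ln r) / w).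
    + assert (hlr : ln r = ln (w * (PI / 2)) - w * l).
      { unfold r; rewrite ln_mult, ln_exp; [lra | | apply exp_pos].
        apply Rmult_lt_0_compat; lra. }
      assert (ln (w * (PI / 2)) < ln (r + w * (PI / 2)))
        by (apply ln_increasing; nra).
      apply (Rmult_lt_reg_r w); trivial.
      unfold Rdiv; rewrite Rmult_assoc, Rinv_l by lra; lra.
    + rewrite <- e.
      destruct hq as [-> | ->].
      * rewrite Rabs_right; trivial.
        apply Rle_ge; rewrite Rmin_left in hm by nra; rewrite hm.
        apply Rlt_le, Rlt_0_minus, ln_increasing; nra.
      * rewrite Rabs_left1; [field; lra |].
        rewrite Rmin_right in hm by nra; rewrite hm.
        apply Rle_minus, Rlt_le, ln_increasing; nra.
  - rewrite <- (is_RInt_unique _ _ _ _ hI').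
    apply RInt_le; [lra | eexists; exact hI' | apply ex_flight; trivial |].
    intros t ht; apply Rinv_le_contravar; [| apply hle; lra].
    apply sqrt_lt_R0, speed2_pos; trivial. }
assert (hsin : forall t, Rabs (sin t) <= Rabs t /\ Rabs (sin t) <= Rabs (PI - t)).
{ intros t; split; [apply abs_sin_le |].
  rewrite <- sin_PI_x; apply abs_sin_le. }
assert (hcos : forall t, Rabs (cos t) <= Rabs (PI / 2 - t)).
{ intros t; rewrite <- sin_shift; apply abs_sin_le. }
destruct (Rle_dec 0 kappa) as [hka | hka].
- (* the speed degenerates at the zeros of sin *)
  rewrite Rabs_right in hw0, hw1 by lra.
  (* This mu makes the minimum of the speed, taken where sin = 0, equal to r^2. *)
  assert (hnd : nondeg n (r ^ 2 - kappa) kappa) by (split; nra).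
  exists (r ^ 2 - kappa); split; trivial.
  assert (hsp : forall t, sqrt (speed2 n (r ^ 2 - kappa) kappa t) <=
    r + w * Rabs (sin t)).
  { intros t; apply sqrt_add_sqr_le; try lra.
    unfold speed2.
    pose proof (sin2_unit t) as hs; pose proof (geo_le_near_0 n _ hs).
    apply Rle_trans with (r ^ 2 + kappa * (INR n * sin t ^ 2)); nra. }
  destruct ha as [-> | ->].
  + apply (hmain _ r w hnd); [left; trivial | rewrite Rmin_left; nra |].
    intros t ht; apply Rle_trans with (1 := hsp t).
    destruct (hsin t) as [h _]; rewrite (Rabs_right t) in h by lra; nra.
  + apply (hmain _ (r + w * PI) (- w) hnd);
      [right; trivial | rewrite Rmin_right; nra |].
    intros t ht; apply Rle_trans with (1 := hsp t).
    destruct (hsin t) as [_ h]; rewrite (Rabs_right (PI - t)) in h by lra; nra.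
- (* the speed degenerates at the zeros of cos *)
  rewrite Rabs_left in hw0, hw1 by lra.
  assert (hnd : nondeg n (r ^ 2 - (INR n + 1) * kappa) kappa) by (split; nra).
  exists (r ^ 2 - (INR n + 1) * kappa); split; trivial.
  assert (hsp : forall t, sqrt (speed2 n (r ^ 2 - (INR n + 1) * kappa) kappa t) <=
    r + w * Rabs (cos t)).
  { intros t; apply sqrt_add_sqr_le; try lra.
    unfold speed2.
    pose proof (sin2_unit t) as hs; pose proof (geo_ge_near_1 n _ hs).
    pose proof (sin2_cos2 t) as hsc; unfold Rsqr in hsc.
    replace (1 - sin t ^ 2) with (cos t ^ 2) in * by (simpl; lra).
    apply Rle_trans with (r ^ 2 + - kappa * ((INR n + 1) ^ 2 * cos t ^ 2)); [nra |].
    pose proof (pow2_ge_0 (cos t)); nra. }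
  destruct ha as [-> | ->].
  + apply (hmain _ (r + w * (PI / 2)) (- w) hnd);
      [right; trivial | rewrite Rmin_right; nra |].
    intros t ht; apply Rle_trans with (1 := hsp t).
    pose proof (hcos t) as h; rewrite (Rabs_right (PI / 2 - t)) in h by lra; nra.
  + apply (hmain _ (r - w * (PI / 2)) w hnd);
      [left; trivial | rewrite Rmin_left; nra |].
    intros t ht; apply Rle_trans with (1 := hsp t).
    pose proof (hcos t) as h; rewrite (Rabs_minus_sym (PI / 2) t) in h.
    rewrite (Rabs_right (t - PI / 2)) in h by lra; nra.
Qed.

(** At the constant speed M^2 the flight is exactly l, so any mu that keeps the speed above M^2 will
    do. *)
Lemma flight_small (n : nat) (kappa a b l : R) :
  a < b -> 0 < l ->
  exists mu, nondeg n mu kappa /\ flight n mu kappa a b < l.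
Proof.
intros hab hl.
pose (M := (b - a) / l).
assert (hM : 0 < M) by (apply Rdiv_lt_0_compat; lra).
assert (hn := pos_INR n).
pose (mu := M ^ 2 + 1 + (INR n + 1) * Rabs kappa).
assert (hlow : M ^ 2 + 1 <= mu + kappa /\ M ^ 2 + 1 <= mu + (INR n + 1) * kappa).
{ pose proof (Rle_abs (- kappa)); rewrite Rabs_Ropp in H.
  pose proof (Rabs_pos kappa); unfold mu; split; nra. }
assert (hM2 : 0 < M ^ 2) by (apply pow_lt; trivial).
assert (hnd : nondeg n mu kappa) by (split; lra).
exists mu; split; trivial.
replace l with (flight n (M ^ 2) 0 a b).
- apply flight_lt; trivial; [split; lra |].
  intros t; apply Rlt_le_trans with (M ^ 2 + 1); [unfold speed2; lra |].
  apply speed2_ge; lra.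
- rewrite flight_const, sqrt_pow2 by lra; unfold M; field; lra.
Qed.

(** Intermediate values between the two preceding lemmas; [nondeg] is preserved when mu grows, so
    all of [m1, m2] is admissible. *)
Lemma flight_level (n : nat) (kappa a b l : R) :
  a = 0 \/ a = PI / 2 -> a + PI / 2 <= b -> 0 < l ->
  exists mu, nondeg n mu kappa /\ flight n mu kappa a b = l.
Proof.
intros ha hb hl.
assert (hab : a < b) by (pose proof PI2_1; lra).
destruct (flight_unbounded n kappa a b l ha hb hl) as [m1 [h1 f1]].
destruct (flight_small n kappa a b l hab hl) as [m2 [h2 f2]].
assert (hm : m1 < m2) by (apply (flight_mu_lt_iff n _ _ kappa a b); trivial; lra).
destruct (IVT_interv (fun m => l - flight n m kappa a b) m1 m2) as [z [hz hz']];
  trivial; try lra.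
- intros m hm'; apply continuity_pt_minus.
  + apply continuity_pt_const; intros ? ?; reflexivity.
  + apply flight_continuous; [| lra].
    destruct h1, h2; split; lra.
- exists z; split; [| lra].
  destruct h1; split; lra.
Qed.

Lemma level_unique (n : nat) (mu mu' kappa a b : R) :
  nondeg n mu kappa -> nondeg n mu' kappa -> a < b ->
  flight n mu kappa a b = flight n mu' kappa a b -> mu = mu'.
Proof.
intros h h' hab he.
destruct (Rtotal_order mu mu') as [hlt | [-> | hlt]]; trivial.
- apply (flight_mu_lt_iff n mu mu' kappa a b) in hlt; trivial; lra.
- apply (flight_mu_lt_iff n mu' mu kappa a b) in hlt; trivial; lra.
Qed.

(* Raising kappa by d raises the speed, but by no more than raising mu by
   (n + 1) d does. *)
Lemma level_lipschitz (n : nat) (mu mu' kappa kappa' a b : R) :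
  nondeg n mu kappa -> nondeg n mu' kappa' -> a < b ->
  flight n mu kappa a b = flight n mu' kappa' a b ->
  Rabs (mu - mu') <= (INR n + 1) * Rabs (kappa - kappa').
Proof.
assert (H : forall m m' k k', nondeg n m k -> nondeg n m' k' -> a < b ->
  flight n m k a b = flight n m' k' a b -> k <= k' ->
  Rabs (m - m') <= (INR n + 1) * Rabs (k - k')).
{ intros m m' k k' h h' hab he hk.
  assert (hn := pos_INR n).
  rewrite (Rabs_left1 (k - k')) by lra.
  apply Rabs_le; split; apply Rnot_lt_le; intros hlt.
  - assert (flight n m' k' a b < flight n m k a b); [| lra].
    apply flight_lt; trivial; intros t; unfold speed2.
    pose proof (geo_bounds n _ (sin2_unit t)); nra.
  - assert (flight n m k a b < flight n m' k' a b); [| lra].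
    apply flight_lt; trivial; intros t; unfold speed2.
    pose proof (geo_bounds n _ (sin2_unit t)); nra. }
intros h h' hab he.
destruct (Rle_dec kappa kappa') as [hk | hk]; [apply H; trivial |].
rewrite (Rabs_minus_sym mu), (Rabs_minus_sym kappa).
apply H; trivial; [symmetry; trivial | lra].
Qed.

(** * Second order equations on a segment *)

Lemma is_derive_continuity_pt (f : R -> R) (x d : R) :
  is_derive f x d -> continuity_pt f x.
Proof.
intros h; apply derivable_continuous_pt; exists d; apply is_derive_Reals; exact h.
Qed.

Lemma derive_nonneg_le (f d : R -> R) (a b : R) :
  a <= b -> (forall x, a <= x <= b -> is_derive f x (d x)) ->
  (forall x, a <= x <= b -> 0 <= d x) -> f a <= f b.
Proof.
intros hab hf hd.
destruct (MVT_gen f a b d) as [c [hc e]];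
  rewrite ?Rmin_left, ?Rmax_right in * by trivial.
- intros x hx; apply hf; lra.
- intros x hx; apply (is_derive_continuity_pt f x (d x)), hf; trivial.
- specialize (hd c hc); nra.
Qed.

Lemma derive_zero_const (f : R -> R) (a b : R) :
  (forall x, a <= x <= b -> is_derive f x 0) ->
  forall x y, a <= x <= b -> a <= y <= b -> f x = f y.
Proof.
intros hf.
assert (H : forall x y, a <= x <= b -> a <= y <= b -> x <= y -> f x = f y).
{ intros x y hx hy hxy; apply Rle_antisym.
  - apply (derive_nonneg_le f (fun _ => 0)); trivial; intros; [| lra].
    apply hf; lra.
  - apply Ropp_le_cancel.
    apply (derive_nonneg_le (fun t => - f t) (fun _ => 0)); trivial; intros; [| lra].
    replace 0 with (- 0) by ring; apply @is_derive_opp; apply hf; lra. }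
intros x y hx hy; destruct (Rle_dec x y); [| symmetry]; apply H; trivial; lra.
Qed.

(** A derivative bounded below by m > 0 makes f expand distances by at least m. Hence f is onto the
    whole line and its inverse is Lipschitz with constant 1/m, which controls the difference
    quotients of the inverse. *)
Lemma inverse_function (f d : R -> R) (m : R) :
  0 < m -> (forall t, is_derive f t (d t)) -> (forall t, m <= d t) ->
  exists g, (forall x, f (g x) = x) /\ (forall x, is_derive g x (/ d (g x))).
Proof.
intros hm hf hd.
assert (hexp : forall s t, s <= t -> m * (t - s) <= f t - f s).
{ intros s t hst.
  pose proof (derive_nonneg_le (fun x => f x - m * x) (fun x => d x - m) s t hst) as h.
  cut (f s - m * s <= f t - m * t); [lra |].
  apply h; intros x _; [| specialize (hd x); lra].
  apply @is_derive_minus; [apply hf |].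
  auto_derive; [trivial | ring]. }
assert (hsurj : forall x, {t | f t = x}).
{ intros x; pose (K := Rabs (x - f 0) / m + 1).
  assert (hK : Rabs (x - f 0) < m * K).
  { unfold K; replace (m * (Rabs (x - f 0) / m + 1)) with
      (Rabs (x - f 0) + m) by (field; lra); lra. }
  assert (hK0 : 0 < K).
  { pose proof (Rabs_pos (x - f 0)); apply (Rmult_lt_reg_l m); lra. }
  apply Rabs_def2 in hK.
  pose proof (hexp 0 K) as h1; pose proof (hexp (- K) 0) as h2.
  destruct (IVT_interv (fun t => f t - x) (- K) K) as [t [_ ht]]; try lra.
  - intros t _; apply continuity_pt_minus.
    + apply (is_derive_continuity_pt f t (d t)), hf.
    + apply continuity_pt_const; intros ? ?; reflexivity.
  - exists t; lra. }
assert (hg : exists g, forall x, f (g x) = x).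
{ exists (fun x => proj1_sig (hsurj x)); intros x; apply (proj2_sig (hsurj x)). }
destruct hg as [g hg]; exists g.
split; [exact hg |].
assert (hgl : forall x y, m * Rabs (g y - g x) <= Rabs (y - x)).
{ intros x y.
  cut (m * Rabs (g y - g x) <= Rabs (f (g y) - f (g x))); [rewrite !hg; trivial |].
  destruct (Rle_dec (g x) (g y)) as [h | h].
  - pose proof (hexp _ _ h) as he.
    rewrite (Rabs_right (g y - g x)) by lra; pose proof (Rle_abs (f (g y) - f (g x))); lra.
  - pose proof (hexp (g y) (g x)) as he.
    rewrite (Rabs_left (g y - g x)), Rabs_minus_sym by lra.
    pose proof (Rle_abs (f (g x) - f (g y))); lra. }
intros x; apply is_derive_Reals; intros e he.
assert (hdx := hd (g x)).
(* The error below is (h/k - d) times k / (h d) up to sign, and the latter factor is at most 1 / (m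
   d) in size; this tolerance leaves e/2. *)
destruct (proj1 (is_derive_Reals _ _ _) (hf (g x)) (e * (m * d (g x)) / 2))
  as [dl hdl].
{ apply Rdiv_lt_0_compat; [| lra].
  repeat apply Rmult_lt_0_compat; lra. }
assert (hdm : 0 < m * dl) by (apply Rmult_lt_0_compat; [trivial | apply cond_pos]).
exists (mkposreal _ hdm); simpl; intros h hh0 hh.
pose (k := g (x + h) - g x).
assert (hk : m * Rabs k <= Rabs h).
{ unfold k; replace h with (x + h - x) at 2 by ring; apply hgl. }
assert (hfk : f (g x + k) - f (g x) = h).
{ unfold k; replace (g x + (g (x + h) - g x)) with (g (x + h)) by ring.
  rewrite !hg; ring. }
assert (hk0 : k <> 0).
{ intros e0; rewrite e0, Rplus_0_r in hfk; lra. }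
specialize (hdl k hk0); rewrite hfk in hdl; fold k.
assert (hkd : Rabs k < dl) by (apply (Rmult_lt_reg_l m); lra).
specialize (hdl hkd).
replace (k / h - / d (g x)) with
  ((h / k - d (g x)) * (- k / (h * d (g x)))) by (field; lra).
rewrite Rabs_mult, Rabs_div, Rabs_Ropp, Rabs_mult, (Rabs_right (d (g x)));
  [| lra | apply Rmult_integral_contrapositive_currified; lra].
assert (hap : 0 < Rabs h) by (apply Rabs_pos_lt; trivial).
assert (hr : 0 <= Rabs k / (Rabs h * d (g x)) <= / (m * d (g x))).
{ split.
  - apply Rdiv_le_0_compat; [apply Rabs_pos | apply Rmult_lt_0_compat; lra].
  - apply (Rmult_le_reg_r (m * (Rabs h * d (g x)))).
    + repeat apply Rmult_lt_0_compat; lra.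
    + replace (Rabs k / (Rabs h * d (g x)) * (m * (Rabs h * d (g x)))) with
        (m * Rabs k) by (field; lra).
      replace (/ (m * d (g x)) * (m * (Rabs h * d (g x)))) with (Rabs h)
        by (field; lra).
      exact hk. }
assert (hpi : 0 < / (m * d (g x)))
  by (apply Rinv_0_lt_compat, Rmult_lt_0_compat; lra).
apply Rle_lt_trans with (e * (m * d (g x)) / 2 * / (m * d (g x))).
- apply Rmult_le_compat; [apply Rabs_pos | lra | lra | lra].
- replace (e * (m * d (g x)) / 2 * / (m * d (g x))) with (e / 2) by (field; lra).
  lra.
Qed.

(** * Uniqueness for the initial value problem *)

Definition locally_lipschitz (f : R -> R) : Prop :=
  forall M, exists K, forall a b, Rabs a <= M -> Rabs b <= M ->
    Rabs (f a - f b) <= K * Rabs (a - b).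

(** F'' = f(F) as a first order system. The derivatives are two-sided even at the endpoints, which
    gives access to the calculus of [is_derive]; [D_in_extend] supplies such F and G. *)
Definition system_on (l : R) (f F G : R -> R) : Prop :=
  forall x, seg l x -> is_derive F x (G x) /\ is_derive G x (f (F x)).

Lemma bounded_on_seg (l : R) (F : R -> R) :
  0 < l -> (forall x, seg l x -> continuity_pt F x) ->
  exists x0, seg l x0 /\ forall x, seg l x -> Rabs (F x) <= Rabs (F x0).
Proof.
intros hl hF.
destruct (continuity_ab_maj (fun x => Rabs (F x)) 0 l) as [x0 [h1 h2]].
- lra.
- intros x hx; apply (continuity_pt_comp F Rabs); [apply hF; exact hx |].
  apply Rcontinuity_abs.
- exists x0; split; [exact h2 | exact h1].
Qed.

(* Gronwall: the squared distance w of two solutions satisfies |w'| <= K w. *)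
Lemma ode_unique (l : R) (f F1 G1 F2 G2 : R -> R) (x0 : R) :
  0 < l -> locally_lipschitz f ->
  system_on l f F1 G1 -> system_on l f F2 G2 ->
  seg l x0 -> F1 x0 = F2 x0 -> G1 x0 = G2 x0 ->
  forall x, seg l x -> F1 x = F2 x /\ G1 x = G2 x.
Proof.
intros hl hf h1 h2 hx0 eF eG.
destruct (bounded_on_seg l F1 hl) as [m1 [_ hm1]].
{ intros x hx; apply (is_derive_continuity_pt _ _ _ (proj1 (h1 x hx))). }
destruct (bounded_on_seg l F2 hl) as [m2 [_ hm2]].
{ intros x hx; apply (is_derive_continuity_pt _ _ _ (proj1 (h2 x hx))). }
destruct (hf (Rmax (Rabs (F1 m1)) (Rabs (F2 m2)))) as [K hK].
pose (w := fun x => (F1 x - F2 x) ^ 2 + (G1 x - G2 x) ^ 2).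
pose (dw := fun x => 2 * (F1 x - F2 x) * (G1 x - G2 x) +
  2 * (G1 x - G2 x) * (f (F1 x) - f (F2 x))).
(* With u, p the differences of the two components, |w'| <= 2|u||p| + 2|K||u||p| <= (1 + |K|)(u^2 +
   p^2). *)
pose (L := 1 + Rabs K).
assert (hw : forall x, seg l x -> is_derive w x (dw x)).
{ intros x hx; destruct (h1 x hx) as [a1 a2]; destruct (h2 x hx) as [a3 a4].
  unfold w, dw; auto_derive.
  - repeat split; eexists; eassumption.
  - rewrite (is_derive_unique (fun t : R => F1 t) _ _ a1),
      (is_derive_unique (fun t : R => G1 t) _ _ a2),
      (is_derive_unique (fun t : R => F2 t) _ _ a3),
      (is_derive_unique (fun t : R => G2 t) _ _ a4).
    ring. }
assert (hb : forall x, seg l x -> - (L * w x) <= dw x <= L * w x).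
{ intros x hx.
  assert (hk : Rabs (f (F1 x) - f (F2 x)) <= Rabs K * Rabs (F1 x - F2 x)).
  { apply Rle_trans with (K * Rabs (F1 x - F2 x)).
    - apply hK.
      + apply Rle_trans with (2 := Rmax_l _ _), hm1; exact hx.
      + apply Rle_trans with (2 := Rmax_r _ _), hm2; exact hx.
    - apply Rmult_le_compat_r; [apply Rabs_pos | apply Rle_abs]. }
  unfold dw, w, L.
  revert hk; generalize (F1 x - F2 x) (G1 x - G2 x) (f (F1 x) - f (F2 x)).
  intros u p q hk.
  apply Rabs_le_between.
  apply Rle_trans with (Rabs (2 * u * p) + Rabs (2 * p * q)); [apply Rabs_triang |].
  rewrite !Rabs_mult, (Rabs_right 2) by lra.
  rewrite <- (pow2_abs u), <- (pow2_abs p).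
  revert hk; generalize (Rabs_pos u) (Rabs_pos p) (Rabs_pos q) (Rabs_pos K).
  generalize (Rabs u) (Rabs p) (Rabs q) (Rabs K).
  intros u' p' q' k' hu hp hq hk' hk.
  assert (2 * u' * p' <= u' ^ 2 + p' ^ 2) by (pose proof (pow2_ge_0 (u' - p')); nra).
  assert (p' * q' <= p' * (k' * u')) by (apply Rmult_le_compat_l; trivial).
  assert (k' * (2 * u' * p') <= k' * (u' ^ 2 + p' ^ 2))
    by (apply Rmult_le_compat_l; trivial).
  nra. }
assert (hw0 : w x0 = 0) by (unfold w; rewrite eF, eG; ring).
assert (hwp : forall x, 0 <= w x).
{ intros x; unfold w; pose proof (pow2_ge_0 (F1 x - F2 x));
  pose proof (pow2_ge_0 (G1 x - G2 x)); lra. }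
assert (hE : forall s x, seg l x ->
  is_derive (fun t => w t * exp (s * t)) x ((dw x + s * w x) * exp (s * x))).
{ intros s x hx; pose proof (hw x hx) as hwx; auto_derive.
  - eexists; exact hwx.
  - rewrite (is_derive_unique (fun t : R => w t) _ _ hwx); ring. }
(* To the right of x0 the function w exp(-L t) does not increase, to the left w exp(L t) does not
   decrease, and w vanishes at x0. *)
assert (hz : forall x, seg l x -> w x <= 0).
{ intros x hx.
  destruct (Rle_dec x0 x) as [hle | hle].
  - assert (hm : w x0 * exp (- L * x0) >= w x * exp (- L * x)).
    { apply Rle_ge, Ropp_le_cancel.
      apply (derive_nonneg_le (fun t => - (w t * exp (- L * t)))
        (fun t => - ((dw t + - L * w t) * exp (- L * t)))); trivial;
        unfold seg in *; intros t ht.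
      - apply @is_derive_opp, hE; unfold seg; lra.
      - assert (ht' : seg l t) by (unfold seg; lra).
        pose proof (hb t ht'); pose proof (exp_pos (- L * t)); nra. }
    rewrite hw0 in hm; pose proof (exp_pos (- L * x)); nra.
  - assert (hm : w x * exp (L * x) <= w x0 * exp (L * x0)).
    { apply (derive_nonneg_le (fun t => w t * exp (L * t))
        (fun t => (dw t + L * w t) * exp (L * t)));
        unfold seg in *; [lra | intros t ht; apply hE; unfold seg; lra |].
      intros t ht; assert (ht' : seg l t) by (unfold seg; lra).
      pose proof (hb t ht'); pose proof (exp_pos (L * t)).
      apply Rmult_le_pos; lra. }
    rewrite hw0 in hm; pose proof (exp_pos (L * x)); nra. }
intros x hx; specialize (hz x hx).
pose proof (pow2_ge_0 (F1 x - F2 x)); pose proof (pow2_ge_0 (G1 x - G2 x)).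
unfold w in hz; split; apply Rminus_diag_uniq, Rsqr_0_uniq; unfold Rsqr; nra.
Qed.

Definition nls_field (n : nat) (nu mu y : R) : R :=
  - mu * y - (INR n + 1) * nu * y ^ (2 * n + 1).

Lemma pow_locally_lipschitz (n : nat) : locally_lipschitz (fun y => y ^ n).
Proof.
intros M; induction n as [| n [K hK]].
- exists 0; intros a b _ _; simpl; rewrite Rminus_diag, Rabs_R0; lra.
- exists (Rabs M * Rabs K + Rabs M ^ n); intros a b ha hb.
  replace (a ^ S n - b ^ S n) with (a * (a ^ n - b ^ n) + b ^ n * (a - b))
    by (simpl; ring).
  apply Rle_trans with (1 := Rabs_triang _ _); rewrite !Rabs_mult.
  rewrite Rmult_plus_distr_r.
  pose proof (Rle_abs M); pose proof (Rabs_pos (a - b)).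
  apply Rplus_le_compat.
  + rewrite Rmult_assoc; apply Rmult_le_compat; try apply Rabs_pos; [lra |].
    apply Rle_trans with (1 := hK a b ha hb).
    apply Rmult_le_compat_r; [trivial | apply Rle_abs].
  + apply Rmult_le_compat_r; trivial; rewrite <- RPow_abs.
    apply pow_incr; split; [apply Rabs_pos | lra].
Qed.

Lemma nls_field_locally_lipschitz (n : nat) (nu mu : R) :
  locally_lipschitz (nls_field n nu mu).
Proof.
intros M; destruct (pow_locally_lipschitz (2 * n + 1) M) as [K hK].
exists (Rabs mu + Rabs ((INR n + 1) * nu) * K); intros a b ha hb.
unfold nls_field.
replace (- mu * a - (INR n + 1) * nu * a ^ (2 * n + 1) -
  (- mu * b - (INR n + 1) * nu * b ^ (2 * n + 1))) with
  (- (mu * (a - b)) + - ((INR n + 1) * nu * (a ^ (2 * n + 1) - b ^ (2 * n + 1))))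
  by ring.
apply Rle_trans with (1 := Rabs_triang _ _).
rewrite !Rabs_Ropp, Rabs_mult, (Rabs_mult ((INR n + 1) * nu)).
specialize (hK a b ha hb); pose proof (Rabs_pos ((INR n + 1) * nu)).
rewrite (Rmult_plus_distr_r (Rabs mu)), Rmult_assoc.
apply Rplus_le_compat_l, Rmult_le_compat_l; trivial.
Qed.

(* Outside [0,l] the function is continued by its tangent at the nearest
   endpoint, which makes the one-sided derivatives two-sided. *)
Lemma D_in_extend (l : R) (f d : R -> R) :
  0 < l -> (forall x, seg l x -> D_in f d (seg l) x) ->
  exists F, (forall x, seg l x -> F x = f x) /\
    (forall x, seg l x -> is_derive F x (d x)).
Proof.
intros hl hf.
pose (F := fun x => if Rle_dec x 0 then f 0 + d 0 * x
  else if Rle_dec l x then f l + d l * (x - l) else f x).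
assert (hF : forall x, seg l x -> F x = f x).
{ intros x [hx1 hx2]; unfold F.
  destruct (Rle_dec x 0) as [h | h].
  - replace x with 0 by lra; ring.
  - destruct (Rle_dec l x) as [h' | h']; trivial.
    replace x with l by lra; ring. }
exists F; split; trivial.
intros x hx; apply is_derive_Reals; intros e he.
destruct (hf x hx e he) as [a [ha hlim]].
(* With |h| < r the point x + h can leave the segment only when x is an endpoint, and then only
   through that endpoint. *)
pose (r := if Req_dec_T x 0 then l else if Req_dec_T x l then l else Rmin x (l - x)).
assert (hr : 0 < r).
{ unfold seg in hx; unfold r; destruct (Req_dec_T x 0); [trivial |].
  destruct (Req_dec_T x l); [trivial | apply Rmin_glb_lt; lra]. }
assert (hd : 0 < Rmin a r) by (apply Rmin_glb_lt; trivial).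
exists (mkposreal _ hd); simpl; intros h hh0 hh.
assert (hh1 : Rabs h < a) by (apply Rlt_le_trans with (1 := hh), Rmin_l).
assert (hh2 : Rabs h < r) by (apply Rlt_le_trans with (1 := hh), Rmin_r).
apply Rabs_def2 in hh2.
rewrite (hF x hx).
destruct (Rle_dec 0 (x + h)) as [h1 | h1]; [destruct (Rle_dec (x + h) l) as [h2 | h2] |].
- rewrite hF by (unfold seg; lra).
  specialize (hlim (x + h)); simpl in hlim; unfold Rdist in hlim.
  replace (x + h - x) with h in hlim by ring.
  apply hlim; split; trivial.
  unfold D_x, seg; repeat split; lra.
- assert (ex : x = l).
  { unfold seg in hx; unfold r in hh2; destruct (Req_dec_T x 0); [lra |].
    destruct (Req_dec_T x l); trivial.
    pose proof (Rmin_r x (l - x)); lra. }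
  unfold F; destruct (Rle_dec (x + h) 0); [lra |].
  destruct (Rle_dec l (x + h)); [| lra].
  rewrite ex; replace ((f l + d l * (l + h - l) - f l) / h - d l) with 0
    by (field; trivial).
  rewrite Rabs_R0; trivial.
- assert (ex : x = 0).
  { unfold seg in hx; unfold r in hh2; destruct (Req_dec_T x 0); trivial.
    destruct (Req_dec_T x l); [lra |].
    pose proof (Rmin_l x (l - x)); lra. }
  unfold F; destruct (Rle_dec (x + h) 0); [| lra].
  rewrite ex; replace ((f 0 + d 0 * (0 + h) - f 0) / h - d 0) with 0
    by (field; trivial).
  rewrite Rabs_R0; trivial.
Qed.

Lemma is_derive_D_in (l : R) (f d : R -> R) (x : R) :
  is_derive f x (d x) -> D_in f d (seg l) x.
Proof.
intros h e he.
destruct (proj1 (is_derive_Reals _ _ _) h e he) as [a ha].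
exists a; split; [apply cond_pos |].
intros y [[_ hyx] hy]; simpl in hy |- *; unfold Rdist in hy |- *.
specialize (ha (y - x)); rewrite Rplus_minus in ha.
apply ha; [lra | exact hy].
Qed.

Lemma solves_nls_system (l nu : R) (n : nat) (b1 b2 : bc) (mu : R) (phi : R -> R) :
  0 < l -> solves_nls l nu n b1 b2 mu phi ->
  exists F G, (forall x, seg l x -> F x = phi x) /\
    system_on l (nls_field n nu mu) F G /\ bc_at b1 F G 0 /\ bc_at b2 F G l.
Proof.
intros hl [d [dd [hC [he [hb1 hb2]]]]].
destruct (D_in_extend l phi d hl) as [F [hF hF']].
{ intros x hx; apply (hC x hx). }
destruct (D_in_extend l d dd hl) as [G [hG hG']].
{ intros x hx; apply (hC x hx). }
assert (h0 : seg l 0) by (unfold seg; lra).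
assert (h1 : seg l l) by (unfold seg; lra).
exists F, G; split; [exact hF |]; split; [| split].
- intros x hx; split.
  + rewrite (hG x hx); apply hF'; trivial.
  + replace (nls_field n nu mu (F x)) with (dd x); [apply hG'; trivial |].
    unfold nls_field; rewrite (hF x hx); pose proof (he x hx); lra.
- destruct b1; simpl in *; [rewrite hF | rewrite hG]; trivial.
- destruct b2; simpl in *; [rewrite hF | rewrite hG]; trivial.
Qed.

Lemma system_solves_nls (l nu : R) (n : nat) (b1 b2 : bc) (mu : R) (F G : R -> R) :
  system_on l (nls_field n nu mu) F G -> bc_at b1 F G 0 -> bc_at b2 F G l ->
  solves_nls l nu n b1 b2 mu F.
Proof.
intros h hb1 hb2; exists G, (fun x => nls_field n nu mu (F x)).
split; [| split; [| split; trivial]].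
- intros x hx; destruct (h x hx) as [h1 h2].
  split; [| split]; [apply is_derive_D_in; trivial .. |].
  assert (hc : continuity_pt (fun x => nls_field n nu mu (F x)) x).
  { apply continuity_pt_filterlim.
    apply (@ex_derive_continuous R_AbsRing R_NormedModule
      (fun y => nls_field n nu mu (F y)) x).
    unfold nls_field; auto_derive; repeat split; eexists; exact h1. }
  intros e he; destruct (hc e he) as [a [ha hh]].
  exists a; split; trivial; intros y [[hy hyx] hya]; apply hh.
  split; [split; [exact I | exact hyx] | exact hya].
- intros x hx; unfold nls_field; ring.
Qed.

(** This makes every lemma on the nonlinear equation available for the linear spectrum; for n = 0
    and kappa = 0 the speed is the constant mu. *)
Lemma solves_lin_iff (l : R) (b1 b2 : bc) (mu : R) (phi : R -> R) :
  solves_lin l b1 b2 mu phi <-> solves_nls l 0 0 b1 b2 mu phi.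
Proof.
unfold solves_lin, solves_nls; simpl.
split; intros [d [dd [hC [he hb]]]]; exists d, dd; repeat split; try apply hC;
  try apply hb; trivial; intros x hx; specialize (he x hx); lra.
Qed.

(** * Solutions in polar form *)

Definition bc_angle (b : bc) : R := match b with Dirichlet => 0 | Neumann => PI / 2 end.

(** The shift turns both conditions at l into one equation, [sin (t + bc_angle b) = 0], solved by t
    = [end_angle b k]. *)
Definition end_angle (b : bc) (k : nat) : R := INR k * PI - bc_angle b.

Lemma bc_angle_bounds (b : bc) : 0 <= bc_angle b <= PI / 2.
Proof. pose proof PI2_1; destruct b; simpl; lra. Qed.

(** With two Neumann conditions and k = 1 both angles are PI/2 and nothing is left to traverse; this
    is why 1 is excluded there. *)
Lemma index_set_iff (b1 b2 : bc) (k : nat) :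
  index_set b1 b2 k <-> (1 <= k)%nat /\ bc_angle b1 < end_angle b2 k.
Proof.
pose proof PI2_1 as hpi.
assert (h1 : (1 <= k)%nat -> PI <= INR k * PI).
{ intros h; apply le_INR in h; simpl in h; nra. }
unfold end_angle; destruct b1, b2; simpl.
1-3: split; [intros h; split; trivial; specialize (h1 h); lra | intros [h _]; trivial].
split.
- intros h; split; [lia |]; apply le_INR in h; simpl in h; nra.
- intros [h hlt].
  destruct (Nat.eq_dec k 1) as [-> |]; [simpl in hlt; lra | lia].
Qed.

(** A path of at least a quarter turn is what [flight_unbounded] requires and what lets a solution
    reach both a zero and its amplitude. *)
Lemma end_angle_gap (b1 b2 : bc) (k : nat) :
  index_set b1 b2 k -> bc_angle b1 + PI / 2 <= end_angle b2 k.
Proof.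
pose proof PI2_1 as hpi.
unfold end_angle; destruct b1, b2; simpl; intros h; apply le_INR in h; simpl in h; nra.
Qed.

Lemma end_angle_increasing (b : bc) (j k : nat) : end_angle b j < end_angle b k <-> (j < k)%nat.
Proof.
pose proof PI_RGT_0 as hpi.
unfold end_angle; split; intros h.
- apply INR_lt; nra.
- apply lt_INR in h; nra.
Qed.

(** The angle is the inverse of the flight. As the speed is bounded above, by C, the derivative of
    the flight is bounded below and the inverse exists on the whole line. *)
Lemma angle_exists (n : nat) (mu kappa a : R) :
  nondeg n mu kappa ->
  exists g, (forall x, flight n mu kappa a (g x) = x) /\
    (forall x, is_derive g x (sqrt (speed2 n mu kappa (g x)))).
Proof.
intros h.
pose (C := Rabs (mu + kappa) + Rabs (mu + (INR n + 1) * kappa)).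
assert (hC : 0 < sqrt C).
{ apply sqrt_lt_R0; unfold C; destruct h.
  rewrite !Rabs_right; lra. }
destruct (inverse_function (flight n mu kappa a)
  (fun t => / sqrt (speed2 n mu kappa t)) (/ sqrt C)) as [g [hg hg']].
- apply Rinv_0_lt_compat; trivial.
- intros t; apply flight_derive; trivial.
- intros t; apply Rinv_le_contravar.
  + apply sqrt_lt_R0, speed2_pos; trivial.
  + apply sqrt_le_1_alt; unfold C; destruct h.
    rewrite !Rabs_right by lra; apply speed2_le; lra.
- exists g; split; trivial; intros x.
  rewrite <- (Rinv_inv (sqrt _)); apply hg'.
Qed.

(** In the second derivative the roots cancel and leave c (- sin W + cos W'/2), which
    [speed2_derive] identifies with the field. The factor c may be negative. *)
Lemma angle_solution (n : nat) (nu mu c : R) (g : R -> R) :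
  nondeg n mu (nu * c ^ (2 * n)) ->
  (forall x, is_derive g x (sqrt (speed2 n mu (nu * c ^ (2 * n)) (g x)))) ->
  forall l, system_on l (nls_field n nu mu) (fun x => c * sin (g x))
    (fun x => c * (cos (g x) * sqrt (speed2 n mu (nu * c ^ (2 * n)) (g x)))).
Proof.
set (kappa := nu * c ^ (2 * n)); intros hnd hg l x _.
destruct (speed2_derive n mu kappa (g x)) as [d [hd he]].
assert (hp := speed2_pos n mu kappa (g x) hnd).
assert (hs : 0 < sqrt (speed2 n mu kappa (g x))) by (apply sqrt_lt_R0; trivial).
specialize (hg x); split.
- auto_derive; [eexists; exact hg |].
  rewrite (is_derive_unique (fun t : R => g t) _ _ hg); ring.
- auto_derive.
  + repeat split; trivial; eexists; [exact hg | exact hd | exact hg].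
  + rewrite (is_derive_unique (fun t : R => g t) _ _ hg).
    rewrite (is_derive_unique (fun t : R => speed2 n mu kappa t) _ _ hd).
    transitivity (c * (- sin (g x) * (sqrt (speed2 n mu kappa (g x)) *
      sqrt (speed2 n mu kappa (g x))) + cos (g x) * (d / 2)));
      [field; lra |].
    rewrite sqrt_sqrt, he by lra.
    unfold nls_field, kappa; rewrite Rpow_mult_distr.
    replace (c ^ (2 * n + 1)) with (c ^ (2 * n) * c) by (rewrite pow_add; ring).
    ring.
Qed.

Definition energy (n : nat) (nu mu y z : R) : R :=
  z ^ 2 + mu * y ^ 2 + nu * y ^ (2 * n + 2).

Lemma energy_const (l : R) (n : nat) (nu mu : R) (F G : R -> R) :
  system_on l (nls_field n nu mu) F G ->
  forall x y, seg l x -> seg l y ->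
    energy n nu mu (F x) (G x) = energy n nu mu (F y) (G y).
Proof.
intros h.
apply (derive_zero_const (fun t => energy n nu mu (F t) (G t))).
intros x hx; destruct (h x hx) as [h1 h2].
apply (is_derive_ext (fun t => G t ^ 2 + mu * F t ^ 2 + nu * F t ^ (2 * n + 2)));
  [reflexivity |].
evar_last.
- apply @is_derive_plus; [apply @is_derive_plus |].
  + apply is_derive_pow; exact h2.
  + apply is_derive_scal, is_derive_pow; exact h1.
  + apply is_derive_scal, is_derive_pow; exact h1.
- unfold plus; simpl.
  replace (Init.Nat.pred (n + (n + 0) + 2)) with (2 * n + 1)%nat by lia.
  replace (INR (n + (n + 0) + 2)) with (2 * INR n + 2)
    by (rewrite !plus_INR; simpl; ring).
  unfold nls_field; ring.
Qed.

(** Energy conservation in polar form, divided by alpha^2: the left side is the squared derivative,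
    the right side the loss of potential energy from the amplitude. *)
Lemma cos2_speed2 (n : nat) (mu kappa th : R) :
  cos th ^ 2 * speed2 n mu kappa th =
  mu * (1 - sin th ^ 2) + kappa * (1 - sin th ^ (2 * n + 2)).
Proof.
pose proof (sin2_cos2 th) as h; unfold Rsqr in h.
pose proof (GP_finite (sin th ^ 2) n) as hg.
replace (sin th ^ (2 * n + 2)) with ((sin th ^ 2) ^ (n + 1))
  by (rewrite <- pow_mult; f_equal; lia).
unfold speed2, geo.
change (sum_f_R0 (pow (sin th ^ 2)) n) with
  (sum_f_R0 (fun n0 => (sin th ^ 2) ^ n0) n).
replace (cos th ^ 2) with (1 - sin th ^ 2) by (simpl; lra).
replace ((sin th ^ 2) ^ (n + 1)) with
  (sum_f_R0 (fun n0 => (sin th ^ 2) ^ n0) n * (sin th ^ 2 - 1) + 1) by lra.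
ring.
Qed.

Lemma pow_even_scal (c e : R) (n : nat) : e ^ 2 = 1 -> (e * c) ^ (2 * n) = c ^ (2 * n).
Proof.
intros h; rewrite Rpow_mult_distr, pow_mult, h, pow1; ring.
Qed.

Lemma sin_zero_pos (t : R) : 0 < t -> sin t = 0 -> exists k, (1 <= k)%nat /\ t = INR k * PI.
Proof.
intros ht h; destruct (sin_eq_0_0 t h) as [k hk].
pose proof PI_RGT_0 as hpi.
assert (hz : (0 < k)%Z).
{ apply lt_IZR; nra. }
exists (Z.to_nat k); split; [lia |].
rewrite INR_IZR_INZ, Z2Nat.id by lia; trivial.
Qed.

Lemma sin_nat_PI (k : nat) : sin (INR k * PI) = 0.
Proof. apply sin_eq_0_1; exists (Z.of_nat k); rewrite INR_IZR_INZ; trivial. Qed.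

Lemma bc_end_angle (n : nat) (mu kappa c : R) (b : bc) (g : R -> R) (x : R) :
  nondeg n mu kappa -> c <> 0 ->
  bc_at b (fun x => c * sin (g x))
    (fun x => c * (cos (g x) * sqrt (speed2 n mu kappa (g x)))) x <->
  sin (g x + bc_angle b) = 0.
Proof.
intros h hc.
assert (hs : 0 < sqrt (speed2 n mu kappa (g x)))
  by (apply sqrt_lt_R0, speed2_pos; trivial).
destruct b; simpl.
- rewrite Rplus_0_r; split; intros e; [| rewrite e; ring].
  apply Rmult_integral in e; tauto.
- rewrite (Rplus_comm (g x)), <- cos_sin; split; intros e; [| rewrite e; ring].
  apply Rmult_integral in e; destruct e as [e | e]; [tauto |].
  apply Rmult_integral in e; destruct e as [e | e]; [trivial | lra].
Qed.

(** The energy fixes the initial data up to a sign e. Under Dirichlet it determines z^2; under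
    Neumann, y = alpha sin t with [Rabs y <= alpha], and cos^2 t W = 0 with W > 0 forces y to be
    alpha or -alpha. *)
Lemma polar_start (l : R) (n : nat) (nu mu alpha : R) (b : bc) (y z : R) :
  0 < alpha -> nondeg n mu (nu * alpha ^ (2 * n)) ->
  (b = Dirichlet -> y = 0) -> (b = Neumann -> z = 0) -> Rabs y <= alpha ->
  energy n nu mu y z = energy n nu mu alpha 0 ->
  exists e, (e = 1 \/ e = -1) /\ y = e * alpha * sin (bc_angle b) /\
    z = e * alpha *
      (cos (bc_angle b) * sqrt (speed2 n mu (nu * alpha ^ (2 * n)) (bc_angle b))).
Proof.
intros ha hnd hD hN hy he.
set (kappa := nu * alpha ^ (2 * n)) in *.
assert (hpow : alpha ^ (2 * n + 2) = alpha ^ (2 * n) * alpha ^ 2)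
  by (rewrite pow_add; ring).
unfold energy in he; rewrite hpow in he.
destruct b; simpl bc_angle; rewrite ?sin_0, ?cos_0, ?sin_PI2, ?cos_PI2.
- specialize (hD eq_refl); subst y.
  rewrite pow_add in he; simpl (0 ^ 2) in he.
  assert (hs : speed2 n mu kappa 0 = mu + kappa).
  { pose proof (cos2_speed2 n mu kappa 0) as hc.
    rewrite sin_0, cos_0, pow_add in hc; simpl (0 ^ 2) in hc; lra. }
  assert (hp : 0 < mu + kappa) by apply hnd.
  rewrite hs; set (r := sqrt (mu + kappa)).
  assert (hr : r * r = mu + kappa) by (apply sqrt_sqrt; lra).
  assert (hz : (z - alpha * r) * (z + alpha * r) = 0).
  { replace ((z - alpha * r) * (z + alpha * r)) with
      (z ^ 2 - alpha ^ 2 * (r * r)) by ring.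
    rewrite hr; unfold kappa; lra. }
  apply Rmult_integral in hz; destruct hz as [hz | hz].
  + exists 1; split; [left; trivial |]; split; lra.
  + exists (-1); split; [right; trivial |]; split; lra.
- specialize (hN eq_refl); subst z.
  pose (s := y / alpha).
  assert (hys : y = alpha * s) by (unfold s; field; lra).
  assert (hs1 : Rabs s <= 1).
  { unfold s; rewrite Rabs_div, (Rabs_right alpha) by lra.
    apply (Rmult_le_reg_r alpha); trivial.
    unfold Rdiv; rewrite Rmult_assoc, Rinv_l; lra. }
  apply Rabs_le_between in hs1.
  assert (hcs : cos (asin s) ^ 2 * speed2 n mu kappa (asin s) = 0).
  { rewrite cos2_speed2, sin_asin by lra.
    apply (Rmult_eq_reg_l (alpha ^ 2)); [| apply pow_nonzero; lra].
    rewrite hys, !Rpow_mult_distr, hpow in he; unfold kappa; lra. }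
  assert (hc2 : cos (asin s) ^ 2 = 0).
  { pose proof (speed2_pos n mu kappa (asin s) hnd).
    apply Rmult_integral in hcs; lra. }
  assert (hss : (s - 1) * (s + 1) = 0).
  { pose proof (sin2_cos2 (asin s)) as hh; unfold Rsqr in hh.
    rewrite sin_asin in hh by lra; simpl in hc2; lra. }
  apply Rmult_integral in hss; destruct hss as [hz | hz].
  + exists 1; split; [left; trivial |]; split; [| ring].
    rewrite hys; replace s with 1 by lra; ring.
  + exists (-1); split; [right; trivial |]; split; [| ring].
    rewrite hys; replace s with (-1) by lra; ring.
Qed.

(** The polar solution with the same initial data equals F by [ode_unique]. The condition at l then
    makes g l + [bc_angle b2] a positive multiple of PI, and k is that multiple. *)
Lemma solution_polar (l : R) (n : nat) (nu mu alpha : R) (b1 b2 : bc) (F G : R -> R) :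
  0 < l -> 0 < alpha -> nondeg n mu (nu * alpha ^ (2 * n)) ->
  system_on l (nls_field n nu mu) F G -> bc_at b1 F G 0 -> bc_at b2 F G l ->
  Rabs (F 0) <= alpha ->
  energy n nu mu (F 0) (G 0) = energy n nu mu alpha 0 ->
  exists k g c, index_set b1 b2 k /\
    flight n mu (nu * alpha ^ (2 * n)) (bc_angle b1) (end_angle b2 k) = l /\
    (forall x, flight n mu (nu * alpha ^ (2 * n)) (bc_angle b1) (g x) = x) /\
    c <> 0 /\ forall x, seg l x -> F x = c * sin (g x).
Proof.
intros hl ha hnd hsys hb1 hb2 hF0 he.
destruct (polar_start l n nu mu alpha b1 (F 0) (G 0)) as [e [hee [ey ez]]]; trivial.
{ intros ->; exact hb1. }
{ intros ->; exact hb1. }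
assert (he2 : e ^ 2 = 1) by (destruct hee as [-> | ->]; ring).
destruct (angle_exists n mu (nu * alpha ^ (2 * n)) (bc_angle b1) hnd) as [g [hg hg']].
assert (hc : e * alpha <> 0) by (destruct hee as [-> | ->]; lra).
assert (hg0 : g 0 = bc_angle b1).
{ apply Rle_antisym; apply Rnot_lt_le; intros hlt;
    apply (flight_lt_iff n mu (nu * alpha ^ (2 * n)) (bc_angle b1)) in hlt; trivial;
    rewrite hg, flight_point in hlt; lra. }
assert (hcan := angle_solution n nu mu (e * alpha) g).
(* The sign e disappears from the even power, so e alpha and alpha share the same kappa. *)
rewrite (pow_even_scal alpha e n he2) in hcan.
specialize (hcan hnd hg' l).
assert (h0 : seg l 0) by (unfold seg; lra).
assert (h1 : seg l l) by (unfold seg; lra).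
assert (hu := ode_unique l _ _ _ _ _ 0 hl (nls_field_locally_lipschitz n nu mu)
  hsys hcan h0); simpl in hu; rewrite hg0 in hu; specialize (hu ey ez).
assert (hbl : sin (g l + bc_angle b2) = 0).
{ apply (bc_end_angle n mu (nu * alpha ^ (2 * n)) (e * alpha) b2 g l hnd hc).
  destruct (hu l h1) as [u1 u2]; destruct b2; simpl in *; [rewrite <- u1 | rewrite <- u2];
    trivial. }
assert (hgl : bc_angle b1 < g l).
{ apply (flight_lt_iff n mu (nu * alpha ^ (2 * n)) (bc_angle b1)); trivial.
  rewrite hg, flight_point; trivial. }
destruct (sin_zero_pos (g l + bc_angle b2)) as [k [hk1 hk]]; trivial.
{ pose proof (bc_angle_bounds b1); pose proof (bc_angle_bounds b2); lra. }
assert (ek : end_angle b2 k = g l) by (unfold end_angle; lra).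
exists k, g, (e * alpha).
split; [| split; [| split; [| split]]]; trivial.
- apply index_set_iff; split; trivial; lra.
- rewrite ek; apply hg.
- intros x hx; apply (hu x hx).
Qed.

(** The flight increases with its end angle, so zeros in (0, l) correspond to multiples of PI
    strictly between the boundary angles. The start lies in [0, PI/2] and the end in
    [k PI - PI/2, k PI], which leaves j PI with 1 <= j <= k - 1 for all pairs of conditions. *)
Lemma polar_zero_count (l : R) (n k : nat) (mu kappa c : R) (b1 b2 : bc) (F g : R -> R) :
  nondeg n mu kappa -> index_set b1 b2 k ->
  flight n mu kappa (bc_angle b1) (end_angle b2 k) = l ->
  (forall x, flight n mu kappa (bc_angle b1) (g x) = x) ->
  c <> 0 -> (forall x, seg l x -> F x = c * sin (g x)) ->
  has_card (fun x => 0 < x < l /\ F x = 0) (k - 1).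
Proof.
intros hnd hk hl hg hc hF.
assert (hlt : forall s t, flight n mu kappa (bc_angle b1) s < flight n mu kappa (bc_angle b1) t
  <-> s < t) by (intros; apply flight_lt_iff; trivial).
pose proof (bc_angle_bounds b1) as hb1; pose proof (bc_angle_bounds b2) as hb2.
pose proof PI_RGT_0 as hpi.
assert (hinj : forall s t, flight n mu kappa (bc_angle b1) s = flight n mu kappa (bc_angle b1) t
  -> s = t).
{ intros s t e; destruct (Rtotal_order s t) as [h | [h | h]]; trivial;
    apply hlt in h; lra. }
exists (map (fun j => flight n mu kappa (bc_angle b1) (INR j * PI)) (seq 1 (k - 1))).
split; [| split].
- apply Injective_map_NoDup; [| apply seq_NoDup].
  intros i j e; apply hinj in e; apply INR_eq; nra.
- rewrite length_map, length_seq; trivial.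
- intros x; rewrite in_map_iff; split.
  + intros [j [<- hj]]; apply in_seq in hj.
    assert (hx : 0 < flight n mu kappa (bc_angle b1) (INR j * PI) < l).
    { rewrite <- (flight_point n mu kappa (bc_angle b1)), <- hl, !hlt.
      destruct hj as [hj1 hj2].
      assert (hj3 : (j + 1 <= k)%nat) by lia.
      apply le_INR in hj1, hj3; rewrite plus_INR in hj3; simpl in hj1, hj3.
      unfold end_angle; split; nra. }
    split; trivial.
    rewrite hF by (unfold seg; lra).
    rewrite (hinj _ _ (hg _)), sin_nat_PI; ring.
  + intros [hx e].
    rewrite hF in e by (unfold seg; lra).
    apply Rmult_integral in e; destruct e as [e | e]; [tauto |].
    rewrite <- hl, <- (flight_point n mu kappa (bc_angle b1)), <- (hg x), !hlt in hx.
    destruct (sin_zero_pos (g x)) as [j [hj1 hj]]; trivial; [lra |].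
    exists j; rewrite <- hj; split; [apply hg |].
    apply in_seq; split; trivial.
    assert (hjk : (j < k)%nat); [| lia].
    apply INR_lt; rewrite hj in hx; unfold end_angle in hx; nra.
Qed.

Lemma polar_solution_exists (l : R) (n k : nat) (nu mu alpha : R) (b1 b2 : bc) :
  0 < l -> 0 < alpha -> nondeg n mu (nu * alpha ^ (2 * n)) ->
  index_set b1 b2 k ->
  flight n mu (nu * alpha ^ (2 * n)) (bc_angle b1) (end_angle b2 k) = l ->
  exists phi, solves_nls l nu n b1 b2 mu phi /\
    (exists x, seg l x /\ phi x = 0) /\
    (forall x, Rabs (phi x) <= alpha) /\ (exists x, seg l x /\ phi x = alpha).
Proof.
intros hl ha hnd hk hfl.
destruct (angle_exists n mu (nu * alpha ^ (2 * n)) (bc_angle b1) hnd) as [g [hg hg']].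
assert (hcan := angle_solution n nu mu alpha g hnd hg' l).
assert (hinj : forall s t, flight n mu (nu * alpha ^ (2 * n)) (bc_angle b1) s =
  flight n mu (nu * alpha ^ (2 * n)) (bc_angle b1) t -> s = t).
{ intros s t e; destruct (Rtotal_order s t) as [h | [h | h]]; trivial;
    apply (flight_lt_iff n mu (nu * alpha ^ (2 * n)) (bc_angle b1)) in h; trivial; lra. }
assert (hg0 : g 0 = bc_angle b1) by (apply hinj; rewrite hg, flight_point; trivial).
assert (hgl : g l = end_angle b2 k) by (apply hinj; rewrite hg; symmetry; trivial).
(* The first quarter turn contains PI/2, where the amplitude is attained, and a zero of sin: 0 after
   a Dirichlet start, PI after a Neumann start. *)
assert (hreach : forall t, bc_angle b1 <= t <= bc_angle b1 + PI / 2 ->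
  exists x, seg l x /\ g x = t).
{ intros t ht; exists (flight n mu (nu * alpha ^ (2 * n)) (bc_angle b1) t); split.
  - pose proof (end_angle_gap b1 b2 k hk).
    assert (H0 : forall s s', s <= s' ->
      flight n mu (nu * alpha ^ (2 * n)) (bc_angle b1) s <=
      flight n mu (nu * alpha ^ (2 * n)) (bc_angle b1) s').
    { intros s s' [hs | ->]; [| lra].
      apply Rlt_le, flight_lt_iff; trivial. }
    rewrite <- hfl at 1; split; [| apply H0; lra].
    rewrite <- (flight_point n mu (nu * alpha ^ (2 * n)) (bc_angle b1)) at 1.
    apply H0; lra.
  - apply hinj, hg. }
pose proof PI2_1 as hpi.
assert (ha0 : alpha <> 0) by lra.
exists (fun x => alpha * sin (g x)); split; [| split; [| split]].
- apply (system_solves_nls l nu n b1 b2 mu _ _ hcan);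
    apply bc_end_angle; trivial.
  + rewrite hg0; destruct b1; simpl.
    * rewrite Rplus_0_r; apply sin_0.
    * replace (PI / 2 + PI / 2) with PI by field; apply sin_PI.
  + rewrite hgl; unfold end_angle.
    replace (INR k * PI - bc_angle b2 + bc_angle b2) with (INR k * PI) by ring.
    apply sin_nat_PI.
- destruct b1; simpl in hreach.
  + destruct (hreach 0) as [x [hx e]]; [lra |].
    exists x; rewrite e, sin_0; split; [trivial | ring].
  + destruct (hreach PI) as [x [hx e]]; [lra |].
    exists x; rewrite e, sin_PI; split; [trivial | ring].
- intros x; rewrite Rabs_mult, (Rabs_right alpha) by lra.
  pose proof (SIN_bound (g x)).
  assert (Rabs (sin (g x)) <= 1) by (apply Rabs_le; lra).
  nra.
- destruct (hreach (PI / 2)) as [x [hx e]]; [destruct b1; simpl; lra |].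
  exists x; rewrite e, sin_PI2; split; [trivial | ring].
Qed.

(** * Sup norm and parameter set *)

Lemma sup_norm_attained (l alpha : R) (phi : R -> R) (x0 : R) :
  seg l x0 -> Rabs (phi x0) = alpha ->
  (forall x, seg l x -> Rabs (phi x) <= alpha) -> sup_norm l phi = alpha.
Proof.
intros hx0 e h; unfold sup_norm.
rewrite (is_lub_Rbar_unique _ (Finite alpha)); trivial; split.
- intros y [x [hx ->]]; apply h; trivial.
- intros b hb; apply hb; exists x0; split; [trivial | symmetry; trivial].
Qed.

Lemma root_lt (k : nat) (x a : R) :
  (1 <= k)%nat -> 0 <= x -> 0 < a -> x < a ^ k -> root k x < a.
Proof.
intros hk hx ha h; unfold root; destruct (Req_dec_T x 0); trivial.
assert (hk' : 0 < INR k) by (apply lt_0_INR; lia).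
replace a with (Rpower (a ^ k) (/ INR k)).
- apply Rlt_Rpower_l; [apply Rinv_0_lt_compat; trivial | lra].
- rewrite <- Rpower_pow, Rpower_mult, Rinv_r, Rpower_1; trivial; lra.
Qed.

Lemma lt_root (k : nat) (x a : R) :
  (1 <= k)%nat -> 0 < a -> a ^ k < x -> a < root k x.
Proof.
intros hk ha h; pose proof (pow_lt a k ha).
unfold root; destruct (Req_dec_T x 0); [lra |].
assert (hk' : 0 < INR k) by (apply lt_0_INR; lia).
replace a with (Rpower (a ^ k) (/ INR k)).
- apply Rlt_Rpower_l; [apply Rinv_0_lt_compat; trivial | lra].
- rewrite <- Rpower_pow, Rpower_mult, Rinv_r, Rpower_1; trivial; lra.
Qed.

(** For nu > 0 the binding inequality is the one at sin = 0 and gives alpha_0 when mu <= 0; for nu <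
    0 it is the one at sin^2 = 1 and gives alpha_c. *)
Lemma nondeg_Pset (nu : R) (n : nat) (mu alpha : R) :
  nu <> 0 -> (1 <= n)%nat -> 0 < alpha -> nondeg n mu (nu * alpha ^ (2 * n)) ->
  Pset nu n (mu, alpha).
Proof.
intros hnu hn ha [h1 h2].
assert (hp := pow_lt alpha (2 * n) ha).
assert (hk : (1 <= 2 * n)%nat) by lia.
assert (hn1 := pos_INR n).
destruct (Rlt_le_dec 0 nu) as [hpos | hneg]; [left | right]; split; try lra.
- destruct (Rlt_le_dec 0 mu) as [hm | hm]; [left | right]; simpl; split; trivial.
  apply root_lt; trivial; [apply Rabs_pos |].
  rewrite Rabs_left1.
  + apply (Rmult_lt_reg_l nu); trivial.
    replace (nu * - (mu / nu)) with (- mu) by (field; trivial); lra.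
  + apply (Rmult_le_reg_l nu); trivial.
    replace (nu * (mu / nu)) with mu by (field; trivial); lra.
- assert (hnn : nu < 0) by lra; clear hneg.
  assert (0 < mu) by nra.
  split; simpl; trivial; split; trivial.
  apply lt_root; trivial.
  assert (hc : 0 < - ((INR n + 1) * nu)) by nra.
  rewrite Rabs_left1.
  + apply (Rmult_lt_reg_l (- ((INR n + 1) * nu))); trivial.
    replace (- ((INR n + 1) * nu) * - (mu / ((INR n + 1) * nu))) with mu
      by (field; lra); lra.
  + apply (Rmult_le_reg_l (- ((INR n + 1) * nu))); trivial.
    replace (- ((INR n + 1) * nu) * (mu / ((INR n + 1) * nu))) with (- mu)
      by (field; lra); lra.
Qed.

(** * Nondegeneracy of solutions with a zero *)

Lemma ivt_seg (l : R) (f : R -> R) (p q y : R) :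
  (forall x, seg l x -> continuity_pt f x) -> seg l p -> seg l q ->
  f p < y < f q -> exists x, seg l x /\ f x = y.
Proof.
intros hf hp hq hy; unfold seg in *.
assert (hy' : forall x, continuity_pt (fun _ : R => y) x)
  by (intros x; apply continuity_pt_const; intros ? ?; reflexivity).
destruct (Rtotal_order p q) as [h | [-> | h]]; [| lra |].
- destruct (IVT_interv (fun x => f x - y) p q) as [x [hx e]]; try lra.
  + intros x hx; apply continuity_pt_minus; [apply hf; lra | apply hy'].
  + exists x; split; lra.
- destruct (IVT_interv (fun x => y - f x) q p) as [x [hx e]]; try lra.
  + intros x hx; apply continuity_pt_minus; [apply hy' | apply hf; lra].
  + exists x; split; lra.
Qed.

(** The identity of [cos2_speed2] with u in place of sin^2, usable before the speed is known to be
    positive and an angle exists. *)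
Lemma energy_level_momentum (n : nat) (nu mu alpha u z y : R) :
  y ^ 2 = alpha ^ 2 * u -> energy n nu mu y z = energy n nu mu alpha 0 ->
  z ^ 2 = alpha ^ 2 * ((1 - u) * (mu + nu * alpha ^ (2 * n) * geo n u)).
Proof.
intros hy he; unfold energy in he.
replace (2 * n + 2)%nat with (2 * (n + 1))%nat in he by lia.
rewrite !pow_mult, hy, Rpow_mult_distr, (pow_add (alpha ^ 2)), <- pow_mult in he.
pose proof (GP_finite u n) as hg; unfold geo.
change (sum_f_R0 (pow u) n) with (sum_f_R0 (fun n0 => u ^ n0) n).
replace (u ^ (n + 1)) with
  (sum_f_R0 (fun n0 => u ^ n0) n * (u - 1) + 1) in he by lra.
rewrite pow_1 in he; lra.
Qed.

(** At an endpoint a Dirichlet condition contradicts [F x0 <> 0] and a Neumann condition is the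
    claim. Inside, the extremum is that of F^2, which unlike |F| is visibly differentiable. *)
Lemma max_critical (l : R) (f F G : R -> R) (b1 b2 : bc) (x0 : R) :
  system_on l f F G -> bc_at b1 F G 0 -> bc_at b2 F G l ->
  seg l x0 -> F x0 <> 0 -> (forall x, seg l x -> Rabs (F x) <= Rabs (F x0)) ->
  G x0 = 0.
Proof.
intros hs h1 h2 hx0 hne hmax.
destruct (Req_dec_T x0 0) as [-> | hn0]; [destruct b1; simpl in h1; tauto |].
destruct (Req_dec_T x0 l) as [-> | hnl]; [destruct b2; simpl in h2; tauto |].
assert (hd : derivable_pt_lim (fun x => F x ^ 2) x0 (2 * F x0 * G x0)).
{ apply is_derive_Reals; pose proof (proj1 (hs x0 hx0)) as hF.
  auto_derive; [eexists; exact hF |].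
  rewrite (is_derive_unique (fun t : R => F t) _ _ hF); ring. }
pose (pr := exist _ _ hd : derivable_pt (fun x => F x ^ 2) x0).
assert (e : derive_pt (fun x => F x ^ 2) x0 pr = 0).
{ unfold seg in hx0; apply (deriv_maximum _ 0 l); try lra.
  intros x hxa hxb; rewrite <- (pow2_abs (F x)), <- (pow2_abs (F x0)).
  apply pow_incr; split; [apply Rabs_pos | apply hmax; unfold seg; lra]. }
simpl in e; apply Rmult_integral in e; destruct e as [e | e]; trivial.
lra.
Qed.

Lemma zero_solution (l : R) (n : nat) (nu mu : R) :
  system_on l (nls_field n nu mu) (fun _ => 0) (fun _ => 0).
Proof.
intros x _; replace (nls_field n nu mu 0) with 0.
- split; apply @is_derive_const.
- unfold nls_field; rewrite pow_add; simpl; ring.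
Qed.

Lemma const_solution (l : R) (n : nat) (nu mu y : R) :
  nls_field n nu mu y = 0 ->
  system_on l (nls_field n nu mu) (fun _ => y) (fun _ => 0).
Proof.
intros e x _; rewrite e; split; apply @is_derive_const.
Qed.

(* All values of |F| in [0, alpha] are taken, so G^2 >= 0 forces the speed to be
   nonnegative everywhere; if it vanished somewhere, F would be constant. *)
Lemma max_nondeg (l : R) (n : nat) (nu mu : R) (F G : R -> R) (z x0 : R) :
  0 < l -> system_on l (nls_field n nu mu) F G ->
  seg l z -> F z = 0 -> seg l x0 -> F x0 <> 0 -> G x0 = 0 ->
  nondeg n mu (nu * Rabs (F x0) ^ (2 * n)).
Proof.
intros hl hs hz ez hx0 hne hG.
set (alpha := Rabs (F x0)); set (kappa := nu * alpha ^ (2 * n)).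
assert (ha : 0 < alpha) by (apply Rabs_pos_lt; trivial).
assert (ha2 : alpha ^ 2 = F x0 ^ 2) by (apply pow2_abs).
assert (ha2p : 0 < alpha ^ 2) by (apply pow_lt; trivial).
assert (hE : forall x, seg l x ->
  energy n nu mu (F x) (G x) = energy n nu mu alpha 0).
{ intros x hx; rewrite (energy_const l n nu mu F G hs x x0 hx hx0), hG.
  unfold energy; rewrite ha2.
  replace (2 * n + 2)%nat with (2 * (n + 1))%nat by lia.
  rewrite !pow_mult, ha2; ring. }
assert (hcont : forall x, seg l x -> continuity_pt (fun t => F t ^ 2) x).
{ intros x hx; apply (continuity_pt_comp F (fun y => y ^ 2)).
  - apply (is_derive_continuity_pt _ _ _ (proj1 (hs x hx))).
  - apply derivable_continuous_pt, derivable_pt_pow. }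
assert (hq : forall u, 0 < u < 1 -> 0 <= mu + kappa * geo n u).
{ intros u hu.
  destruct (ivt_seg l (fun t => F t ^ 2) z x0 (alpha ^ 2 * u) hcont hz hx0)
    as [x [hx ex]].
  { rewrite ez, <- ha2; simpl (0 ^ 2); nra. }
  pose proof (energy_level_momentum n nu mu alpha u (G x) (F x) ex (hE x hx)) as hg.
  pose proof (pow2_ge_0 (G x)) as hg0; rewrite hg in hg0; fold kappa in hg0.
  apply Rnot_lt_le; intros hlt.
  assert (0 < alpha ^ 2 * (1 - u)) by (apply Rmult_lt_0_compat; lra).
  nra. }
assert (hGz : G z ^ 2 = alpha ^ 2 * (mu + kappa)).
{ assert (hy : F z ^ 2 = alpha ^ 2 * 0) by (rewrite ez; simpl; ring).
  rewrite (energy_level_momentum n nu mu alpha 0 (G z) (F z) hy (hE z hz)); f_equal.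
  fold kappa.
  assert (hg0 : geo n 0 = 1).
  { clear; induction n as [| n IH]; unfold geo in *; [reflexivity |].
    rewrite tech5, IH; simpl; ring. }
  rewrite hg0; ring. }
assert (h1 : 0 <= mu + kappa).
{ pose proof (pow2_ge_0 (G z)); apply (Rmult_le_reg_l (alpha ^ 2)); lra. }
assert (hn := pos_INR n).
assert (h2 : 0 <= mu + (INR n + 1) * kappa).
{ destruct (Rle_dec 0 kappa) as [hk | hk]; [nra |].
  apply Rnot_lt_le; intros hlt.
  assert (hA : 0 < (INR n + 1) ^ 2 * - kappa)
    by (apply Rmult_lt_0_compat; [apply pow_lt |]; lra).
  assert (hD : 0 < - (mu + (INR n + 1) * kappa)) by lra.
  remember ((INR n + 1) ^ 2 * - kappa) as A eqn:eA.
  remember (- (mu + (INR n + 1) * kappa)) as D eqn:eD.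
  (* By [geo_ge_near_1] the speed at u = 1 - d is at most - D + A d, which for this d is - D^2 / (D
     + A) < 0 and contradicts [hq]. *)
  pose (d := D / (D + A)).
  assert (hdA : d * (D + A) = D) by (unfold d; field; lra).
  assert (hd : 0 < d < 1) by (split; [apply Rdiv_lt_0_compat |]; nra).
  specialize (hq (1 - d)); pose proof (geo_ge_near_1 n (1 - d)) as hg.
  replace (1 - (1 - d)) with d in hg by ring.
  specialize (hq ltac:(lra)); specialize (hg ltac:(lra)).
  assert (kappa * geo n (1 - d) <= kappa * (INR n + 1 - (INR n + 1) ^ 2 * d)) by nra.
  nra. }
assert (hlip := nls_field_locally_lipschitz n nu mu).
(* Equality in [h1] gives zero data at z and hence the zero solution. Equality in [h2] makes the
   constant F x0 a solution with the same data at x0, which excludes the zero z. *)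
split; [destruct h1 as [h1 | h1]; trivial | destruct h2 as [h2 | h2]; trivial]; exfalso.
- apply hne.
  destruct (ode_unique l _ F G _ _ z hl hlip hs (zero_solution l n nu mu) hz)
    with (x := x0) as [e _]; trivial.
  rewrite <- h1 in hGz; apply Rsqr_0_uniq; unfold Rsqr; lra.
- apply hne; rewrite <- ez; symmetry.
  destruct (ode_unique l _ F G (fun _ => F x0) (fun _ => 0) x0 hl hlip hs)
    with (x := z) as [e _]; trivial.
  apply const_solution; unfold nls_field; rewrite pow_add, pow_mult, <- ha2, <- pow_mult.
  fold kappa in h2; unfold kappa in h2.
  replace (- mu * F x0 - (INR n + 1) * nu * (alpha ^ (2 * n) * F x0 ^ 1)) with
    (- (mu + (INR n + 1) * (nu * alpha ^ (2 * n))) * F x0) by ring.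
  rewrite <- h2; ring.
Qed.

(** Where |F| is largest its derivative vanishes, so the energy is that of the data (alpha, 0) with
    alpha the sup norm; this alpha is the amplitude of the polar form. *)
Lemma Phi_int_polar (l nu : R) (n : nat) (b1 b2 : bc) (mu : R) (phi : R -> R) :
  0 < l -> Phi_int l nu n b1 b2 phi -> solves_nls l nu n b1 b2 mu phi ->
  0 < sup_norm l phi /\ nondeg n mu (nu * sup_norm l phi ^ (2 * n)) /\
  exists k, index_set b1 b2 k /\
    flight n mu (nu * sup_norm l phi ^ (2 * n)) (bc_angle b1) (end_angle b2 k) = l /\
    has_card (fun x => 0 < x < l /\ phi x = 0) (k - 1).
Proof.
intros hl [[x1 [hx1 hne1]] [_ [z [hz ez]]]] hsol.
destruct (solves_nls_system l nu n b1 b2 mu phi hl hsol)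
  as [F [G [hF [hs [hb1 hb2]]]]].
destruct (bounded_on_seg l F hl) as [x0 [hx0 hmax]].
{ intros x hx; apply (is_derive_continuity_pt _ _ _ (proj1 (hs x hx))). }
assert (hne : F x0 <> 0).
{ intros e; specialize (hmax x1 hx1); rewrite e, Rabs_R0, hF in hmax by trivial.
  pose proof (Rabs_pos_lt _ hne1); lra. }
assert (hsup : sup_norm l phi = Rabs (F x0)).
{ apply (sup_norm_attained l _ phi x0 hx0).
  - rewrite hF; trivial.
  - intros x hx; rewrite <- hF by trivial; apply hmax; trivial. }
rewrite hsup.
assert (hG : G x0 = 0) by (apply (max_critical l _ F G b1 b2 x0 hs); trivial).
assert (hnd : nondeg n mu (nu * Rabs (F x0) ^ (2 * n))).
{ apply (max_nondeg l n nu mu F G z x0); trivial; rewrite hF; trivial. }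
assert (ha : 0 < Rabs (F x0)) by (apply Rabs_pos_lt; trivial).
assert (h0 : seg l 0) by (unfold seg; lra).
split; [trivial | split; [trivial |]].
destruct (solution_polar l n nu mu (Rabs (F x0)) b1 b2 F G)
  as [k [g [c [hk [hfl [hg [hc hFg]]]]]]]; trivial.
- apply hmax; trivial.
- rewrite (energy_const l n nu mu F G hs 0 x0 h0 hx0), hG; unfold energy.
  replace (2 * n + 2)%nat with (2 * (n + 1))%nat by lia.
  rewrite !pow_mult, pow2_abs; ring.
- exists k; split; [trivial | split; [trivial |]].
  apply (polar_zero_count l n k mu (nu * Rabs (F x0) ^ (2 * n)) c b1 b2 phi g); trivial.
  intros x hx; rewrite <- hF; trivial; apply hFg; trivial.
Qed.

(** * The linear spectrum *)

(** The solution mu of (b - a) / sqrt mu = l for the two boundary angles. With two Neumann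
    conditions k = 1 gives 0, the eigenvalue of the constants, so the numbering agrees with that of
    the branches, which start at 2 there. *)
Definition lin_level (l : R) (b1 b2 : bc) (k : nat) : R :=
  ((end_angle b2 k - bc_angle b1) / l) ^ 2.

Lemma flight_lin (l mu a b : R) :
  0 < l -> 0 < mu -> a < b ->
  ((b - a) / sqrt mu = l <-> mu = ((b - a) / l) ^ 2).
Proof.
intros hl hmu hab.
assert (hs : 0 < sqrt mu) by (apply sqrt_lt_R0; trivial).
split; intros e.
- rewrite <- e, <- (sqrt_sqrt mu) at 1 by lra; field; lra.
- assert (hq : 0 < (b - a) / l) by (apply Rdiv_lt_0_compat; lra).
  rewrite e, sqrt_pow2 by lra; field; lra.
Qed.

(** The product F G has derivative G^2 - mu F^2 >= 0 and vanishes at both ends, hence everywhere. So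
    F^2 is constant, G = 0, and the equation leaves mu = 0. *)
Lemma nonpos_eigenvalue (l mu : R) (b1 b2 : bc) (F G : R -> R) :
  0 < l -> mu <= 0 -> system_on l (nls_field 0 0 mu) F G ->
  bc_at b1 F G 0 -> bc_at b2 F G l -> (exists x, seg l x /\ F x <> 0) ->
  mu = 0 /\ b1 = Neumann /\ b2 = Neumann.
Proof.
intros hl hmu hs hb1 hb2 [x1 [hx1 hne]].
assert (hfield : forall y, nls_field 0 0 mu y = - mu * y)
  by (intros y; unfold nls_field; simpl; ring).
assert (hmono : forall x y, seg l x -> seg l y -> x <= y -> F x * G x <= F y * G y).
{ intros x y hx hy hxy.
  apply (derive_nonneg_le (fun t => F t * G t) (fun t => G t ^ 2 + - mu * F t ^ 2));
    trivial; intros t ht; assert (ht' : seg l t) by (unfold seg in *; lra).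
  - destruct (hs t ht') as [d1 d2]; rewrite hfield in d2.
    auto_derive; [repeat split; eexists; eassumption |].
    rewrite (is_derive_unique (fun t : R => F t) _ _ d1),
      (is_derive_unique (fun t : R => G t) _ _ d2); ring.
  - pose proof (pow2_ge_0 (F t)); pose proof (pow2_ge_0 (G t)); nra. }
assert (h0 : seg l 0) by (unfold seg; lra).
assert (h1 : seg l l) by (unfold seg; lra).
assert (e0 : F 0 * G 0 = 0) by (destruct b1; simpl in hb1; rewrite hb1; ring).
assert (e1 : F l * G l = 0) by (destruct b2; simpl in hb2; rewrite hb2; ring).
assert (hFG : forall x, seg l x -> F x * G x = 0).
{ intros x hx; pose proof (hmono 0 x h0 hx); pose proof (hmono x l hx h1).
  unfold seg in hx; lra. }
assert (hF2 : forall x, seg l x -> F x ^ 2 = F x1 ^ 2).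
{ intros x hx; apply (derive_zero_const (fun t => F t ^ 2) 0 l); trivial.
  intros t ht; destruct (hs t ht) as [d1 _].
  auto_derive; [eexists; exact d1 |].
  rewrite (is_derive_unique (fun t : R => F t) _ _ d1).
  pose proof (hFG t ht); lra. }
assert (hFne : forall x, seg l x -> F x <> 0).
{ intros x hx e; specialize (hF2 x hx); rewrite e in hF2.
  apply hne, Rsqr_0_uniq; unfold Rsqr; simpl in hF2; lra. }
assert (hG : forall x, seg l x -> G x = 0).
{ intros x hx; destruct (Rmult_integral _ _ (hFG x hx)) as [e | e]; trivial.
  exfalso; apply (hFne x hx e). }
split.
- destruct (MVT_gen G 0 l (fun t => - mu * F t)) as [c [hc ec]];
    rewrite ?Rmin_left, ?Rmax_right in * by lra.
  + intros t ht; rewrite <- hfield; apply hs; unfold seg; lra.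
  + intros t ht; apply (is_derive_continuity_pt _ _ _ (proj2 (hs t ht))).
  + rewrite (hG 0 h0), (hG l h1) in ec.
    pose proof (hFne c hc).
    assert (e : mu * (F c * l) = 0) by lra.
    apply Rmult_integral in e; destruct e as [e | e]; trivial.
    apply Rmult_integral in e; lra.
- split; [destruct b1 | destruct b2]; trivial; exfalso.
  + apply (hFne 0 h0 hb1).
  + apply (hFne l h1 hb2).
Qed.

Lemma eigenvalue_lin_iff (l : R) (b1 b2 : bc) (mu : R) :
  0 < l ->
  (eigenvalue_lin l b1 b2 mu <->
   exists k, (1 <= k)%nat /\ mu = lin_level l b1 b2 k).
Proof.
intros hl; unfold lin_level; split.
- intros [phi [[x1 [hx1 hne]] hsol]]; apply solves_lin_iff in hsol.
  destruct (solves_nls_system l 0 0 b1 b2 mu phi hl hsol)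
    as [F [G [hF [hs [hb1 hb2]]]]].
  rewrite <- (hF x1 hx1) in hne.
  destruct (Rle_dec mu 0) as [hmu | hmu].
  + destruct (nonpos_eigenvalue l mu b1 b2 F G) as [-> [-> ->]]; trivial.
    { exists x1; split; trivial. }
    exists 1%nat; split; [lia |]; unfold end_angle; simpl; field; lra.
  + assert (hm : 0 < mu) by lra; clear hmu.
    assert (h0 : seg l 0) by (unfold seg; lra).
    pose (E := G 0 ^ 2 + mu * F 0 ^ 2).
    assert (hE : 0 < E).
    { apply Rnot_le_lt; intros hle; unfold E in hle.
      pose proof (pow2_ge_0 (F 0)); pose proof (pow2_ge_0 (G 0)).
      assert (F 0 ^ 2 = 0) by nra; assert (G 0 ^ 2 = 0) by nra.
      apply hne.
      destruct (ode_unique l _ F G _ _ 0 hl (nls_field_locally_lipschitz 0 0 mu)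
        hs (zero_solution l 0 0 mu) h0) with (x := x1) as [e _]; trivial;
        apply Rsqr_0_uniq; unfold Rsqr; lra. }
    (* The amplitude of the harmonic oscillation with energy E = mu alpha^2. *)
    pose (alpha := sqrt (E / mu)).
    assert (hq : 0 < E / mu) by (apply Rdiv_lt_0_compat; trivial).
    assert (ha : 0 < alpha) by (apply sqrt_lt_R0; trivial).
    assert (ha2 : alpha ^ 2 = E / mu) by (apply pow2_sqrt; lra).
    destruct (solution_polar l 0 0 mu alpha b1 b2 F G)
      as [k [g [c [hk [hfl _]]]]]; trivial.
    * split; lra.
    * apply Rsqr_incr_0_var; [| lra].
      rewrite <- Rsqr_abs, !Rsqr_pow2, ha2.
      apply (Rmult_le_reg_l mu); trivial.
      replace (mu * (E / mu)) with E by (field; lra).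
      unfold E; pose proof (pow2_ge_0 (G 0)); lra.
    * unfold energy; rewrite ha2; unfold E; field; lra.
    * rewrite Rmult_0_l, flight_const in hfl.
      apply index_set_iff in hk; destruct hk as [hk hlt].
      exists k; split; trivial; apply flight_lin; trivial.
- intros [k [hk ->]].
  destruct (Rlt_le_dec (bc_angle b1) (end_angle b2 k)) as [hlt | hle].
  + assert (hq : 0 < (end_angle b2 k - bc_angle b1) / l) by (apply Rdiv_lt_0_compat; lra).
    assert (hm : 0 < ((end_angle b2 k - bc_angle b1) / l) ^ 2) by (apply pow_lt; trivial).
    destruct (polar_solution_exists l 0 k 0 (((end_angle b2 k - bc_angle b1) / l) ^ 2) 1 b1 b2)
      as [phi [hsol [_ [_ [x [hx e]]]]]]; trivial; try lra.
    * split; lra.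
    * apply index_set_iff; split; trivial.
    * rewrite Rmult_0_l, flight_const; apply flight_lin; trivial.
    * exists phi; split; [exists x; split; [trivial | lra] |].
      apply solves_lin_iff; trivial.
  (* An empty angular path occurs only for the constant eigenfunction, which has no polar form. *)
  + assert (hNN : b1 = Neumann /\ b2 = Neumann /\ end_angle b2 k = bc_angle b1).
    { pose proof PI2_1; apply le_INR in hk; simpl in hk; unfold end_angle in *.
      destruct b1, b2; simpl in *; repeat split; nra. }
    destruct hNN as [-> [-> ->]].
    exists (fun _ => 1); split.
    * exists 0; split; [unfold seg; lra | lra].
    * apply solves_lin_iff, (system_solves_nls _ _ _ _ _ _ _ (fun _ => 0));
        [| reflexivity | reflexivity].
      apply const_solution; unfold nls_field; simpl; field; lra.
Qed.

Lemma lin_level_lt (l : R) (b1 b2 : bc) (j k : nat) :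
  0 < l -> (1 <= j)%nat -> (1 <= k)%nat ->
  (lin_level l b1 b2 j < lin_level l b1 b2 k <-> (j < k)%nat).
Proof.
intros hl hj hk.
assert (hnn : forall i, (1 <= i)%nat -> 0 <= end_angle b2 i - bc_angle b1).
{ intros i hi; apply le_INR in hi; simpl in hi.
  pose proof PI2_1; pose proof (bc_angle_bounds b1); pose proof (bc_angle_bounds b2).
  unfold end_angle; nra. }
assert (hs : forall i i', (1 <= i)%nat -> (i < i')%nat ->
  lin_level l b1 b2 i < lin_level l b1 b2 i').
{ intros i i' hi hii; pose proof (hnn i hi) as h0.
  apply (end_angle_increasing b2) in hii; unfold lin_level.
  rewrite <- !Rsqr_pow2; apply Rsqr_incrst_1.
  - apply Rmult_lt_compat_r; [apply Rinv_0_lt_compat; trivial | lra].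
  - apply Rdiv_le_0_compat; trivial.
  - apply Rdiv_le_0_compat; trivial; lra. }
split; [| apply hs; trivial].
intros h; destruct (Nat.lt_trichotomy j k) as [h' | [-> | h']]; trivial; [lra |].
apply hs in h'; trivial; lra.
Qed.

Lemma lin_level_nth (l : R) (b1 b2 : bc) (k : nat) :
  0 < l -> (1 <= k)%nat -> nth_eigenvalue_lin l b1 b2 k (lin_level l b1 b2 k).
Proof.
intros hl hk; split; [trivial | split].
- apply eigenvalue_lin_iff; trivial; exists k; split; trivial.
- exists (map (lin_level l b1 b2) (seq 1 (k - 1))); split; [| split].
  + apply Injective_map_NoDup_in; [| apply seq_NoDup].
    intros i j hi hj e; apply in_seq in hi, hj.
    destruct (Nat.lt_trichotomy i j) as [h | [h | h]]; trivial;
      apply (lin_level_lt l b1 b2) in h; trivial; try lia; lra.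
  + rewrite length_map, length_seq; trivial.
  + intros x; rewrite in_map_iff; split.
    * intros [j [<- hj]]; apply in_seq in hj; split.
      -- apply eigenvalue_lin_iff; trivial; exists j; split; [lia | trivial].
      -- apply lin_level_lt; trivial; lia.
    * intros [he hlt]; apply eigenvalue_lin_iff in he; trivial.
      destruct he as [j [hj ->]]; apply lin_level_lt in hlt; trivial.
      exists j; split; trivial; apply in_seq; lia.
Qed.

(** * The branches *)

(** The conjunct [nondeg] is essential: outside it the integrand involves default values of root and
    inverse, and the flight loses its meaning. *)
Definition branch (l nu : R) (n : nat) (b1 b2 : bc) (k : nat) (p : R * R) : Prop :=
  0 < snd p /\ nondeg n (fst p) (nu * snd p ^ (2 * n)) /\
  flight n (fst p) (nu * snd p ^ (2 * n)) (bc_angle b1) (end_angle b2 k) = l.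

Definition branch_mu (l nu : R) (n : nat) (b1 b2 : bc) (k : nat) (alpha : R) : R :=
  iota (fun m => branch l nu n b1 b2 k (m, alpha)).

Lemma branch_mu_spec (l nu : R) (n : nat) (b1 b2 : bc) (k : nat) (alpha m : R) :
  0 < l -> index_set b1 b2 k -> 0 < alpha ->
  (branch l nu n b1 b2 k (m, alpha) <-> m = branch_mu l nu n b1 b2 k alpha).
Proof.
intros hl hk ha.
assert (hu : forall m m', branch l nu n b1 b2 k (m, alpha) ->
  branch l nu n b1 b2 k (m', alpha) -> m = m').
{ intros x y [_ [hx ex]] [_ [hy ey]]; cbn [fst snd] in *.
  apply (level_unique n x y (nu * alpha ^ (2 * n)) (bc_angle b1) (end_angle b2 k)); trivial.
  - apply index_set_iff; trivial.
  - rewrite ex, ey; trivial. }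
assert (hb : branch l nu n b1 b2 k (branch_mu l nu n b1 b2 k alpha, alpha)).
{ apply (iota_correct (fun x : R => branch l nu n b1 b2 k (x, alpha))).
  destruct (flight_level n (nu * alpha ^ (2 * n)) (bc_angle b1) (end_angle b2 k) l)
    as [x [hx ex]]; trivial.
  - destruct b1; simpl; tauto.
  - apply end_angle_gap; trivial.
  - assert (hbx : branch l nu n b1 b2 k (x, alpha)) by (repeat split; trivial; apply hx).
    exists x; split; trivial; intros y hy; apply hu; trivial. }
split; [intros h; apply hu; trivial | intros ->; trivial].
Qed.

(** The base point need not have positive amplitude, so one statement yields both continuity of the
    curve and its limit at alpha = 0. Near alpha0 kappa is Lipschitz in alpha, and [level_lipschitz]
    carries this over to mu. *)
Lemma branch_limit (l nu : R) (n : nat) (b1 b2 : bc) (k : nat) (m0 alpha0 : R) :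
  0 < l -> index_set b1 b2 k -> nondeg n m0 (nu * alpha0 ^ (2 * n)) ->
  flight n m0 (nu * alpha0 ^ (2 * n)) (bc_angle b1) (end_angle b2 k) = l ->
  filterlim (fun alpha => (branch_mu l nu n b1 b2 k alpha, alpha))
    (within (fun alpha => 0 < alpha) (locally alpha0)) (locally (m0, alpha0)).
Proof.
intros hl hk hnd hfl.
destruct (pow_locally_lipschitz (2 * n) (Rabs alpha0 + 1)) as [K hK].
pose (C := (INR n + 1) * Rabs nu * Rabs K).
assert (hn := pos_INR n).
assert (hC : 0 <= C).
{ unfold C; pose proof (Rabs_pos nu); pose proof (Rabs_pos K).
  repeat apply Rmult_le_pos; lra. }
apply filterlim_locally; intros eps.
(* The bound 1 keeps alpha in the range of the Lipschitz constant K, eps serves the second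
   coordinate, and the last bound serves the first. *)
assert (hd : 0 < Rmin (Rmin 1 eps) (eps / (C + 1))).
{ pose proof (cond_pos eps).
  repeat apply Rmin_glb_lt; try lra; apply Rdiv_lt_0_compat; lra. }
exists (mkposreal _ hd); intros alpha hal ha.
change (Rabs (alpha - alpha0) < Rmin (Rmin 1 eps) (eps / (C + 1))) in hal.
assert (hal1 : Rabs (alpha - alpha0) < 1).
{ apply Rlt_le_trans with (1 := hal), Rle_trans with (1 := Rmin_l _ _), Rmin_l. }
assert (hal2 : Rabs (alpha - alpha0) < eps).
{ apply Rlt_le_trans with (1 := hal), Rle_trans with (1 := Rmin_l _ _), Rmin_r. }
assert (hal3 : Rabs (alpha - alpha0) < eps / (C + 1)).
{ apply Rlt_le_trans with (1 := hal), Rmin_r. }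
split; [| exact hal2].
change (Rabs (branch_mu l nu n b1 b2 k alpha - m0) < eps).
destruct (proj2 (branch_mu_spec l nu n b1 b2 k alpha _ hl hk ha) eq_refl)
  as [_ [hnd' hfl']]; cbn [fst snd] in hnd', hfl'.
apply Rle_lt_trans with (C * Rabs (alpha - alpha0)).
- apply Rle_trans with
    ((INR n + 1) * Rabs (nu * alpha ^ (2 * n) - nu * alpha0 ^ (2 * n))).
  + apply (level_lipschitz n _ _ _ _ (bc_angle b1) (end_angle b2 k)); trivial.
    * apply index_set_iff; trivial.
    * rewrite hfl, hfl'; trivial.
  + rewrite <- Rmult_minus_distr_l, Rabs_mult.
    unfold C; rewrite !Rmult_assoc.
    apply Rmult_le_compat_l; [lra |].
    apply Rmult_le_compat_l; [apply Rabs_pos |].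
    apply Rle_trans with (K * Rabs (alpha - alpha0)).
    * apply hK; [| lra].
      replace alpha with (alpha0 + (alpha - alpha0)) by ring.
      apply Rle_trans with (1 := Rabs_triang _ _); lra.
    * apply Rmult_le_compat_r; [apply Rabs_pos | apply Rle_abs].
- apply Rle_lt_trans with ((C + 1) * Rabs (alpha - alpha0)).
  + pose proof (Rabs_pos (alpha - alpha0)); lra.
  + apply (Rmult_lt_compat_l (C + 1)) in hal3; [| lra].
    replace ((C + 1) * (eps / (C + 1))) with (pos eps) in hal3 by (field; lra).
    trivial.
Qed.

(** At one point p the speed is the same for both indices, and a longer angular path takes strictly
    longer. *)
Lemma branch_disjoint (l nu : R) (n : nat) (b1 b2 : bc) (j k : nat) (p : R * R) :
  branch l nu n b1 b2 j p -> branch l nu n b1 b2 k p -> j = k.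
Proof.
intros [_ [hnd hj]] [_ [_ hk]].
assert (H : forall i i', (i < i')%nat ->
  flight n (fst p) (nu * snd p ^ (2 * n)) (bc_angle b1) (end_angle b2 i) <
  flight n (fst p) (nu * snd p ^ (2 * n)) (bc_angle b1) (end_angle b2 i')).
{ intros i i' h; apply flight_lt_iff; trivial; apply end_angle_increasing; trivial. }
destruct (Nat.lt_trichotomy j k) as [h | [h | h]]; trivial; apply H in h; lra.
Qed.

(** For a graph over the amplitude the second projection is a continuous inverse of the
    parametrization. *)
Lemma branch_simple_curve (l nu : R) (n : nat) (b1 b2 : bc) (k : nat) :
  0 < l -> index_set b1 b2 k -> simple_curve (branch l nu n b1 b2 k).
Proof.
intros hl hk.
exists (fun t => 0 < t), (fun t => (branch_mu l nu n b1 b2 k t, t)), snd.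
split; [| split; [| split; [| split]]].
- split; [exists 1, 2; lra | intros a b x; lra].
- intros [m a]; split.
  + intros h; assert (ha : 0 < a) by apply h.
    exists a; split; trivial; f_equal; symmetry.
    apply branch_mu_spec; trivial.
  + intros [t [ht e]]; injection e; intros <- <-.
    apply branch_mu_spec; trivial.
- reflexivity.
- intros t ht.
  destruct (proj2 (branch_mu_spec l nu n b1 b2 k t _ hl hk ht) eq_refl)
    as [_ [hnd hfl]].
  apply branch_limit; trivial.
- intros [m a] _; apply filterlim_filter_le_1 with (2 := continuous_snd m a).
  apply filter_le_within.
Qed.

Theorem theorem2p4 (l nu : R) (sigma : nat) (b1 b2 : bc)
    (hl : 0 < l) (hnu : nu <> 0) (hsigma : (1 <= sigma)%nat) :
  exists gamma : nat -> R * R -> Prop,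
    (forall n, index_set b1 b2 n -> forall p, gamma n p -> Pset nu sigma p) /\
    (* (1) *)
    ((forall p : R * R,
        (exists phi, Phi_int l nu sigma b1 b2 phi /\
                     Lambda_int l nu sigma b1 b2 phi = p) <->
        (exists n, index_set b1 b2 n /\ gamma n p)) /\
     (forall n m p, index_set b1 b2 n -> index_set b1 b2 m ->
        gamma n p -> gamma m p -> n = m) /\
     (forall n, index_set b1 b2 n -> simple_curve (gamma n))) /\
    (* (2) *)
    (forall n phi, index_set b1 b2 n -> Phi_int l nu sigma b1 b2 phi ->
       gamma n (Lambda_int l nu sigma b1 b2 phi) ->
       has_card (fun x => 0 < x < l /\ phi x = 0) (n - 1)) /\
    exists mu : nat -> R -> R,
      (* (3) *)
      (forall alpha, 0 < alpha ->
         (forall n, index_set b1 b2 n ->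
            forall m : R, gamma n (m, alpha) <-> m = mu n alpha) /\
         (forall n n', index_set b1 b2 n -> index_set b1 b2 n' ->
            (n < n')%nat -> mu n alpha < mu n' alpha)) /\
      (* (4) *)
      (forall n, index_set b1 b2 n ->
         exists mulin : R,
           nth_eigenvalue_lin l b1 b2 n mulin /\
           filterlim (fun alpha => (mu n alpha, alpha))
             (at_right 0) (locally (mulin, 0))).
Proof.
assert (hphi : forall phi, Phi_int l nu sigma b1 b2 phi ->
  exists k, index_set b1 b2 k /\
    branch l nu sigma b1 b2 k (Lambda_int l nu sigma b1 b2 phi) /\
    has_card (fun x => 0 < x < l /\ phi x = 0) (k - 1)).
{ intros phi h.
  destruct (Phi_int_polar l nu sigma b1 b2 _ phi hl h
    (Lambda_int_solves l nu sigma b1 b2 phi hl h)) as [ha [hnd [k [hk [hfl hc]]]]].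
  exists k; repeat split; trivial; apply hnd. }
exists (branch l nu sigma b1 b2); split; [| split; [split; [| split] | split]].
- intros n _ [m a] [ha [hnd _]]; apply nondeg_Pset; trivial.
- intros [m a]; split.
  + intros [phi [h <-]]; destruct (hphi phi h) as [k [hk [hb _]]].
    exists k; split; trivial.
  + intros [k [hk [ha [hnd hfl]]]]; cbn [fst snd] in *.
    destruct (polar_solution_exists l sigma k nu m a b1 b2 hl ha hnd hk hfl)
      as [phi [hsol [hz [hmax [x [hx ex]]]]]].
    assert (h : Phi_int l nu sigma b1 b2 phi).
    { split; [exists x; split; [trivial | lra] | split; trivial].
      exists m; trivial. }
    exists phi; split; trivial.
    rewrite (surjective_pairing (Lambda_int _ _ _ _ _ _)); f_equal.
    * apply (solves_nls_mu_unique l nu sigma b1 b2 phi); trivial; [apply h |].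
      apply Lambda_int_solves; trivial.
    * apply (sup_norm_attained l a phi x); trivial.
      rewrite ex; apply Rabs_right; lra.
- intros n m p _ _; apply branch_disjoint.
- intros n hn; apply branch_simple_curve; trivial.
(* The zero count is known for the branch that the polar form provides; disjointness identifies it
   with the given one. *)
- intros n phi hn h hb; destruct (hphi phi h) as [k [hk [hb' hc]]].
  rewrite (branch_disjoint l nu sigma b1 b2 n k _ hb hb'); trivial.
- exists (branch_mu l nu sigma b1 b2); split.
  + intros a ha; split.
    * intros n hn m; apply branch_mu_spec; trivial.
    * intros n n' hn hn' hlt.
      destruct (proj2 (branch_mu_spec l nu sigma b1 b2 n a _ hl hn ha) eq_refl)
        as [_ [h1 e1]].
      destruct (proj2 (branch_mu_spec l nu sigma b1 b2 n' a _ hl hn' ha) eq_refl)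
        as [_ [h2 e2]].
      cbn [fst snd] in *.
      apply (flight_mu_lt_iff sigma _ _ (nu * a ^ (2 * sigma)) (bc_angle b1) (end_angle b2 n));
        trivial; [apply index_set_iff; trivial |].
      (* With the parameter of n' the longer path takes l, so the path to the n-th end angle takes
         less than l; with the parameter of n it takes exactly l. *)
      rewrite e1; refine (Rlt_le_trans _ _ _ _ (Req_le _ _ e2)).
      apply flight_lt_iff; trivial.
      apply end_angle_increasing; trivial.
  + intros n hn; exists (lin_level l b1 b2 n); split.
    * apply lin_level_nth; trivial; apply (index_set_iff b1 b2 n); trivial.
    * assert (hlt := proj2 (proj1 (index_set_iff b1 b2 n) hn)).
      assert (hq : 0 < (end_angle b2 n - bc_angle b1) / l) by (apply Rdiv_lt_0_compat; lra).
      assert (hm : 0 < lin_level l b1 b2 n) by (apply pow_lt; trivial).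
      (* Since sigma >= 1, amplitude 0 corresponds to kappa = 0, where the flight is explicit. *)
      assert (e0 : nu * 0 ^ (2 * sigma) = 0) by (rewrite pow_i by lia; ring).
      apply branch_limit; trivial; rewrite e0.
      -- split; lra.
      -- rewrite flight_const; apply flight_lin; trivial.
Qed.
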